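(* Let $1\le q_1<p<q_2$. Assume that (i) $X$ is an asymptotically $p$-uniformly smooth Banach space with the $p$-co-Banach-Saks property which does not contain $\ell_1$; (ii) $Y_1$ is a Banach space with a $1$-unconditional basis satisfying a lower $\ell_{q_1}$-estimate with constant $1$; and (iii) $Y_2$ is a reflexive asymptotically $q_2$-uniformly smooth Banach space. Then $X$ does not coarse Lipschitz embed into $Y_1\oplus Y_2$.
   Context: A space $Z$ is asymptotically $r$-uniformly smooth if $\overline\rho_Z(t)\le Ct^r$ on $[0,1]$ for some $C$, where $\overline{\rho}_Z(t)=\sup_{z\in\partial B_Z}\inf_{\dim(Z/E)<\infty}\sup_{h\in\partial B_E}\|z+th\|-1$. $X$ has the $p$-co-Banach-Saks property if every semi-normalized weakly null sequence $(x_n)$ has a subsequence $(x_{n_j})$ and $c>0$ with $\|x_{n_{j_1}}+\dots+x_{n_{j_k}}\|\ge ck^{1/p}$ for all $k\le j_1<\dots<j_k$. A $1$-unconditional basis satisfies a lower $\ell_q$-estimate with constant $1$ if $\|y_1+\dots+y_k\|^q\ge\sum\|y_n\|^q$ for disjointly supported $y_n$. A coarse Lipschitz embedding is a map $f$ with $\omega_f(t)\le Lt+L$ and $\rho_f(t)\ge L^{-1}t-L$ for some $L>0$, where $\omega_f(t)=\sup\{\|f(x)-f(y)\|:\|x-y\|\le t\}$, $\rho_f(t)=\inf\{\|f(x)-f(y)\|:\|x-y\|\ge t\}$.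
   Formalization: X is additionally assumed infinite-dimensional; for finite-dimensional X (e.g. the real line) all hypotheses hold vacuously while X embeds linearly into Y_1, so the statement without this assumption is false. *)

(* Defs.v *)
From Stdlib Require Import Reals Lra.
Open Scope R_scope.

Record Banach := {
  car :> Type;
  vzero : car;
  vadd : car -> car -> car;
  vopp : car -> car;
  vscal : R -> car -> car;
  vnorm : car -> R;
  vaddA : forall x y z, vadd x (vadd y z) = vadd (vadd x y) z;
  vaddC : forall x y, vadd x y = vadd y x;
  vadd0 : forall x, vadd x vzero = x;
  vaddN : forall x, vadd x (vopp x) = vzero;
  vscalDr : forall a x y, vscal a (vadd x y) = vadd (vscal a x) (vscal a y);
  vscalDl : forall a b x, vscal (a + b) x = vadd (vscal a x) (vscal b x);
  vscalA : forall a b x, vscal a (vscal b x) = vscal (a * b) x;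
  vscal1 : forall x, vscal 1 x = x;
  vnorm_eq0 : forall x, vnorm x = 0 -> x = vzero;
  vnormZ : forall a x, vnorm (vscal a x) = Rabs a * vnorm x;
  vnorm_tri : forall x y, vnorm (vadd x y) <= vnorm x + vnorm y;
  vcomplete : forall u : nat -> car,
    (forall eps, eps > 0 -> exists N, forall m n, (m >= N)%nat -> (n >= N)%nat ->
       vnorm (vadd (u m) (vopp (u n))) < eps) ->
    exists l, forall eps, eps > 0 -> exists N, forall n, (n >= N)%nat ->
       vnorm (vadd (u n) (vopp l)) < eps
}.

Arguments vzero {_}. Arguments vadd {_}. Arguments vopp {_}.
Arguments vscal {_}. Arguments vnorm {_}.

Definition vsub {X : Banach} (x y : X) : X := vadd x (vopp y).

Fixpoint vsum {X : Banach} (n : nat) (g : nat -> X) : X :=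
  match n with
  | O => vzero
  | S n' => vadd (vsum n' g) (g n')
  end.

(* real power x^q, with the convention 0^q = 0 (used with q > 0) *)
Definition rpow (x q : R) : R :=
  if Rle_dec x 0 then 0 else Rpower x q.

Fixpoint rsum (n : nat) (g : nat -> R) : R :=
  match n with O => 0 | S n' => rsum n' g + g n' end.

Definition is_linear_fun {X : Banach} (f : X -> R) : Prop :=
  (forall x y, f (vadd x y) = f x + f y) /\ (forall a x, f (vscal a x) = a * f x).

Definition in_dual {X : Banach} (f : X -> R) : Prop :=
  is_linear_fun f /\ exists K, forall x, Rabs (f x) <= K * vnorm x.

Definition infinite_dim (X : Banach) : Prop :=
  forall n : nat, exists v : nat -> X, forall c : nat -> R,
    vsum n (fun i => vscal (c i) (v i)) = vzero -> forall i, (i < n)%nat -> c i = 0.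

Definition finite_codim_subspace {Z : Banach} (E : Z -> Prop) : Prop :=
  E vzero /\ (forall x y, E x -> E y -> E (vadd x y)) /\
  (forall a x, E x -> E (vscal a x)) /\
  exists (n : nat) (w : nat -> Z), forall z, exists e (c : nat -> R),
    E e /\ z = vadd e (vsum n (fun i => vscal (c i) (w i))).

(* rho-bar_Z(t) <= C t^r on [0,1], with sup/inf unfolded:
   for every z in the unit sphere and eps > 0 there is a finite-codimensional
   subspace E with  ||z + t h|| - 1 <= C t^r + eps  for all h in the sphere of E *)
Definition asymp_unif_smooth (Z : Banach) (r : R) : Prop :=
  exists C : R, forall t, 0 <= t <= 1 ->
    forall z : Z, vnorm z = 1 -> forall eps, eps > 0 ->
      exists E : Z -> Prop, finite_codim_subspace E /\
        forall h, E h -> vnorm h = 1 ->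
          vnorm (vadd z (vscal t h)) - 1 <= C * rpow t r + eps.

Definition weakly_null {X : Banach} (x : nat -> X) : Prop :=
  forall f : X -> R, in_dual f -> Un_cv (fun n => f (x n)) 0.

Definition semi_normalized {X : Banach} (x : nat -> X) : Prop :=
  exists a b, 0 < a /\ forall n, a <= vnorm (x n) <= b.

Definition strictly_incr (phi : nat -> nat) : Prop :=
  forall n, (phi n < phi (S n))%nat.

(* p-co-Banach-Saks property.  The subsequence is y_j = x_(phi j); the
   condition quantifies over k <= j_1 < ... < j_k (stored as j 0 < ... < j (k-1)). *)
Definition co_banach_saks (X : Banach) (p : R) : Prop :=
  forall x : nat -> X, semi_normalized x -> weakly_null x ->
    exists phi : nat -> nat, strictly_incr phi /\ exists c, c > 0 /\
      forall (k : nat) (j : nat -> nat),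
        (forall i, (S i < k)%nat -> (j i < j (S i))%nat) ->
        (k <= j 0%nat)%nat ->
        vnorm (vsum k (fun i => x (phi (j i)))) >= c * rpow (INR k) (1 / p).

(* X contains (an isomorphic copy of) l_1: there is a sequence equivalent to
   the unit vector basis of l_1 *)
Definition contains_l1 (X : Banach) : Prop :=
  exists (x : nat -> X) (c C : R), 0 < c /\
    forall (n : nat) (a : nat -> R),
      c * rsum n (fun i => Rabs (a i)) <= vnorm (vsum n (fun i => vscal (a i) (x i))) <=
      C * rsum n (fun i => Rabs (a i)).

Definition reflexive (X : Banach) : Prop :=
  forall Phi : (X -> R) -> R,
    (forall f g, in_dual f -> in_dual g -> Phi (fun x => f x + g x) = Phi f + Phi g) ->
    (forall a f, in_dual f -> Phi (fun x => a * f x) = a * Phi f) ->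
    (exists M, forall f K, in_dual f -> 0 <= K ->
        (forall x, Rabs (f x) <= K * vnorm x) -> Rabs (Phi f) <= M * K) ->
    exists x : X, forall f, in_dual f -> Phi f = f x.

Definition expansion {Y : Banach} (e : nat -> Y) (a : nat -> R) (y : Y) : Prop :=
  forall eps, eps > 0 -> exists N, forall n, (n >= N)%nat ->
    vnorm (vsub (vsum n (fun i => vscal (a i) (e i))) y) < eps.

Definition schauder_basis {Y : Banach} (e : nat -> Y) : Prop :=
  forall y : Y, exists a, expansion e a y /\
    forall b, expansion e b y -> forall i, b i = a i.

Definition one_unconditional {Y : Banach} (e : nat -> Y) : Prop :=
  schauder_basis e /\
  forall (n : nat) (a eps : nat -> R), (forall i, eps i = 1 \/ eps i = -1) ->
    vnorm (vsum n (fun i => vscal (eps i * a i) (e i))) =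
    vnorm (vsum n (fun i => vscal (a i) (e i))).

Definition lower_lq_estimate {Y : Banach} (e : nat -> Y) (q : R) : Prop :=
  forall (k : nat) (y : nat -> Y) (a : nat -> nat -> R),
    (forall n, (n < k)%nat -> expansion e (a n) (y n)) ->
    (forall n m i, (n < k)%nat -> (m < k)%nat -> n <> m -> a n i = 0 \/ a m i = 0) ->
    rpow (vnorm (vsum k y)) q >= rsum k (fun n => rpow (vnorm (y n)) q).

Definition coarse_lipschitz_embedding {A B : Type}
    (dA : A -> A -> R) (dB : B -> B -> R) (f : A -> B) : Prop :=
  exists L, L > 0 /\
    (forall t x y, dA x y <= t -> dB (f x) (f y) <= L * t + L) /\
    (forall t x y, dA x y >= t -> dB (f x) (f y) >= t / L - L).

Definition dsum {Y1 Y2 : Banach} (u v : Y1 * Y2) : R :=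
  vnorm (vsub (fst u) (fst v)) + vnorm (vsub (snd u) (snd v)).

Definition dX {X : Banach} (x y : X) : R := vnorm (vsub x y).

(* Main.v *)
From mathcomp Require classical_sets.
Require Import Defs.
From Stdlib Require Import Reals Lra Lia Psatz List.
From Stdlib Require Import Classical ClassicalEpsilon FunctionalExtensionality PropExtensionality.
Import ListNotations.
Open Scope R_scope.
Set Bullet Behavior "Strict Subproofs".

(* Let f = (f1, f2) : X -> Y1 (+) Y2 be a coarse Lipschitz embedding. Since X is
   asymptotically p-uniformly smooth, choosing unit vectors one at a time in
   finite-codimensional subspaces gives a sequence (x_n) whose sums of k terms have
   norm at most A k^(1/p); as p > 1, it is weakly null, and co-Banach-Saks provides a
   subsequence with the matching lower bound c k^(1/p).

   If x, y are far apart and nearly realise the Lipschitz constant of f1 at infinity,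
   f1 maps delta-midpoints of x, y to 2 delta-midpoints. In X these contain
   (x+y)/2 + eta |x-y| B_E with E of finite codimension and eta ~ delta^(1/p); in Y1
   they lie within C delta^(1/q1) |x-y| of a compact set. Hence on the points
   phi(n) = (x+y)/2 + tau (x_{n_1} + ... + x_{n_k}), with tau ~ eta |x-y| k^(-1/p), the map f1 is
   almost constant relative to eta |x-y|. On the other hand f2 o phi is
   O(tau)-Lipschitz for the Hamming distance, so by reflexivity and q2-smoothness it
   stays within O(tau k^(1/q2)) of its iterated weak limit. The points phi(n) being
   c tau k^(1/p)/2-separated, taking k large and then delta small is a contradiction.

   "For n_1 large, then n_2 large, ..." is expressed by the k-th power of a free
   ultrafilter on nat; this replaces Ramsey arguments and passages to subsequences. *)

(** * Linear identities and norms *)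

Section Algebra.
Context {X : Banach}.
Implicit Types x y z : X.

Lemma vadd0l x : vadd vzero x = x.
Proof. rewrite vaddC; apply vadd0. Qed.

Lemma vadd_cancel x y z : vadd x y = vadd x z -> y = z.
Proof.
  intros H. rewrite <- (vadd0l y), <- (vadd0l z), <- (vaddN _ x).
  rewrite (vaddC _ x), <- !vaddA, H. reflexivity.
Qed.

Lemma vscal0 x : vscal 0 x = vzero.
Proof.
  apply (vadd_cancel x). rewrite vadd0. rewrite <- (vscal1 _ x) at 1.
  rewrite <- vscalDl. rewrite Rplus_0_r. apply vscal1.
Qed.

Lemma vscalZ a : vscal a vzero = vzero :> X.
Proof. rewrite <- (vscal0 vzero), vscalA, Rmult_0_r. reflexivity. Qed.

Lemma vopp_scal x : vopp x = vscal (-1) x.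
Proof.
  apply (vadd_cancel x). rewrite vaddN. rewrite <- (vscal1 _ x) at 1.
  rewrite <- vscalDl. replace (1 + -1) with 0 by ring. symmetry; apply vscal0.
Qed.

Lemma vaddACA x y z (t : X) : vadd (vadd x y) (vadd z t) = vadd (vadd x z) (vadd y t).
Proof. rewrite <- !vaddA. f_equal. rewrite !vaddA, (vaddC _ y z). reflexivity. Qed.

Lemma vsum_ext n (f g : nat -> X) :
  (forall i, (i < n)%nat -> f i = g i) -> vsum n f = vsum n g.
Proof.
  induction n; simpl; intros H; auto. rewrite IHn, H; auto.
Qed.

Lemma vsum_add n (f g : nat -> X) :
  vsum n (fun i => vadd (f i) (g i)) = vadd (vsum n f) (vsum n g).
Proof.
  induction n; simpl. symmetry; apply vadd0. rewrite IHn. apply vaddACA.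
Qed.

Lemma vsum_scal n a (f : nat -> X) :
  vsum n (fun i => vscal a (f i)) = vscal a (vsum n f).
Proof.
  induction n; simpl. symmetry; apply vscalZ. now rewrite IHn, vscalDr.
Qed.

Lemma vsum_zero n (f : nat -> X) : (forall i, (i < n)%nat -> f i = vzero) -> vsum n f = vzero.
Proof.
  induction n; simpl; intros H; auto. rewrite IHn, H, vadd0; auto.
Qed.

End Algebra.

(* Reflexive decision of linear identities: an expression over the atoms [env]
   is determined by its coefficients. *)
Inductive vex := VX (n : nat) | VZ | VA (a b : vex) | VO (a : vex) | VS (r : R) (a : vex).

Fixpoint vex_eval {X : Banach} (env : list X) (e : vex) : X :=
  match e with
  | VX n => nth n env vzero
  | VZ => vzero
  | VA a b => vadd (vex_eval env a) (vex_eval env b)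
  | VO a => vopp (vex_eval env a)
  | VS r a => vscal r (vex_eval env a)
  end.

Fixpoint vex_coef (e : vex) (i : nat) : R :=
  match e with
  | VX n => if Nat.eqb i n then 1 else 0
  | VZ => 0
  | VA a b => vex_coef a i + vex_coef b i
  | VO a => - vex_coef a i
  | VS r a => r * vex_coef a i
  end.

Fixpoint vex_same (n : nat) (a b : vex) : Prop :=
  match n with
  | O => True
  | S n' => vex_same n' a b /\ vex_coef a n' = vex_coef b n'
  end.

Lemma vex_eval_coef {X : Banach} (env : list X) e :
  vex_eval env e = vsum (length env) (fun i => vscal (vex_coef e i) (nth i env vzero)).
Proof.
  induction e; simpl.
  - assert (H : forall N, vsum N (fun i => vscal (if Nat.eqb i n then 1 else 0) (nth i env vzero))
              = if Nat.ltb n N then nth n env vzero else vzero).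
    { induction N; [reflexivity|]. cbn [vsum]. rewrite IHN.
      destruct (Nat.eqb_spec N n) as [->|E].
      - rewrite Nat.ltb_irrefl. rewrite vscal1, vadd0l.
        destruct (Nat.ltb_spec n (S n)); [reflexivity|lia].
      - rewrite vscal0, vadd0.
        destruct (Nat.ltb_spec n N), (Nat.ltb_spec n (S N)); auto; lia. }
    rewrite H. destruct (Nat.ltb_spec n (length env)); auto.
    now apply nth_overflow.
  - symmetry; apply vsum_zero; intros; apply vscal0.
  - rewrite IHe1, IHe2, <- vsum_add. apply vsum_ext; intros; now rewrite vscalDl.
  - rewrite IHe, vopp_scal, <- vsum_scal. apply vsum_ext; intros.
    rewrite vscalA. f_equal; ring.
  - rewrite IHe, <- vsum_scal. apply vsum_ext; intros. now rewrite vscalA.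
Qed.

Lemma vex_same_eval {X : Banach} (env : list X) a b :
  vex_same (length env) a b -> vex_eval env a = vex_eval env b.
Proof.
  intros H. rewrite !vex_eval_coef.
  revert H. generalize (length env). induction n; simpl; intros H; auto.
  destruct H as [H1 H2]. now rewrite IHn, H2.
Qed.

Ltac vex_mem x l :=
  lazymatch l with
  | nil => constr:(false)
  | cons x _ => constr:(true)
  | cons _ ?l' => vex_mem x l'
  end.
Ltac vex_atoms l t :=
  lazymatch t with
  | vzero => l
  | vadd ?a ?b => let l' := vex_atoms l a in vex_atoms l' b
  | vopp ?a => vex_atoms l a
  | vscal _ ?a => vex_atoms l a
  | ?a => let m := vex_mem a l in
          lazymatch m with true => l | false => constr:(cons a l) end
  end.
Ltac vex_index x l :=
  lazymatch l with
  | cons x _ => constr:(O)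
  | cons _ ?l' => let n := vex_index x l' in constr:(S n)
  end.
Ltac vex_reify l t :=
  lazymatch t with
  | vzero => constr:(VZ)
  | vadd ?a ?b => let a' := vex_reify l a in let b' := vex_reify l b in constr:(VA a' b')
  | vopp ?a => let a' := vex_reify l a in constr:(VO a')
  | vscal ?r ?a => let a' := vex_reify l a in constr:(VS r a')
  | ?a => let n := vex_index a l in constr:(VX n)
  end.
Ltac vlin_goals :=
  unfold vsub;
  lazymatch goal with
  | |- @eq ?T ?a ?b =>
    let l0 := constr:(@nil T) in
    let l1 := vex_atoms l0 a in
    let l := vex_atoms l1 b in
    let a' := vex_reify l a in
    let b' := vex_reify l b in
    change (vex_eval l a' = vex_eval l b');
    apply vex_same_eval; cbn [length vex_same vex_coef Nat.eqb]; repeat split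
  end.
Ltac vlin := vlin_goals; first [ring | field; lra].

Section Norm.
Context {X : Banach}.
Implicit Types x y z : X.

Lemma vnorm0 : vnorm (vzero : X) = 0.
Proof. rewrite <- (vscal0 vzero), vnormZ, Rabs_R0. ring. Qed.

Lemma vnorm_opp x : vnorm (vopp x) = vnorm x.
Proof. rewrite vopp_scal, vnormZ, Rabs_left by lra. ring. Qed.

Lemma vnorm_ge0 x : 0 <= vnorm x.
Proof.
  pose proof (vnorm_tri _ x (vopp x)) as H. rewrite vaddN, vnorm0, vnorm_opp in H. lra.
Qed.

Lemma vnorm_le_add x y z : x = vadd y z -> vnorm x <= vnorm y + vnorm z.
Proof. intros ->; apply vnorm_tri. Qed.

Lemma vnorm_opp_eq x y : x = vopp y -> vnorm x = vnorm y.
Proof. intros ->; apply vnorm_opp. Qed.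

Lemma vnorm_scal_eq a x y : x = vscal a y -> 0 <= a -> vnorm x = a * vnorm y.
Proof. intros -> H; rewrite vnormZ, Rabs_pos_eq; auto. Qed.

Lemma vsub_sym x y : vnorm (vsub x y) = vnorm (vsub y x).
Proof. apply vnorm_opp_eq. vlin. Qed.

Lemma vnorm_pos x : x <> vzero -> 0 < vnorm x.
Proof.
  intros H. destruct (vnorm_ge0 x); auto. symmetry in H0; apply vnorm_eq0 in H0; tauto.
Qed.

Lemma vnorm_unit x : x <> vzero -> vnorm (vscal (/ vnorm x) x) = 1.
Proof.
  intros H. pose proof (vnorm_pos x H).
  rewrite vnormZ, Rabs_pos_eq. field; lra. left; apply Rinv_0_lt_compat; auto.
Qed.

Lemma lin_zero (f : X -> R) : is_linear_fun f -> f vzero = 0.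
Proof. intros [_ H]. rewrite <- (vscal0 vzero), H. ring. Qed.

Lemma lin_opp (f : X -> R) x : is_linear_fun f -> f (vopp x) = - f x.
Proof. intros [_ H]. rewrite vopp_scal, H. ring. Qed.

Lemma lin_sub (f : X -> R) x y : is_linear_fun f -> f (vsub x y) = f x - f y.
Proof. intros H. unfold vsub. destruct H as [H1 H2]; rewrite H1, lin_opp by (split; auto). ring. Qed.

Lemma in_dual_bound (f : X -> R) : in_dual f -> exists K, 0 < K /\ forall x, Rabs (f x) <= K * vnorm x.
Proof.
  intros [_ [K H]]. exists (Rabs K + 1). split.
  - pose proof (Rabs_pos K); lra.
  - intros x. eapply Rle_trans; [apply H|]. apply Rmult_le_compat_r; [apply vnorm_ge0|].
    pose proof (Rle_abs K); lra.
Qed.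

End Norm.

(** * Real powers *)

Lemma rpow_pos x q : 0 < x -> rpow x q = Rpower x q.
Proof. unfold rpow. destruct (Rle_dec x 0); lra. Qed.

Lemma rpow_0 q : rpow 0 q = 0.
Proof. unfold rpow. destruct (Rle_dec 0 0); lra. Qed.

Lemma rpow_gt0 x q : 0 < x -> 0 < rpow x q.
Proof. intros; rewrite rpow_pos; auto; apply exp_pos. Qed.

Lemma rpow_ge0 x q : 0 <= rpow x q.
Proof. unfold rpow. destruct (Rle_dec x 0); [lra|]. left; apply exp_pos. Qed.

Lemma rpow_le x y q : 0 <= q -> x <= y -> rpow x q <= rpow y q.
Proof.
  intros Hq Hxy. destruct (Rle_dec x 0).
  - unfold rpow at 1. destruct (Rle_dec x 0); [apply rpow_ge0|lra].
  - rewrite !rpow_pos by lra. apply Rle_Rpower_l; lra.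
Qed.

Lemma rpow_lt x y q : 0 < q -> 0 <= x < y -> rpow x q < rpow y q.
Proof.
  intros Hq [[H|<-] H']; [|rewrite rpow_0; apply rpow_gt0; auto].
  rewrite !rpow_pos by lra. unfold Rpower. apply exp_increasing.
  apply Rmult_lt_compat_l; auto. apply ln_increasing; auto.
Qed.

Lemma rpow_le_inv x y q : 0 < q -> 0 <= y -> rpow x q <= rpow y q -> x <= y.
Proof.
  intros Hq Hy H. destruct (Rle_dec x y); auto.
  assert (rpow y q < rpow x q) by (apply rpow_lt; lra). lra.
Qed.

Lemma rpow_mult x y q : 0 <= x -> 0 <= y -> rpow (x * y) q = rpow x q * rpow y q.
Proof.
  intros [Hx|<-] [Hy|<-].
  - rewrite !rpow_pos; auto using Rmult_lt_0_compat. symmetry; apply Rpower_mult_distr; auto.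
  - rewrite Rmult_0_r, !rpow_0; ring.
  - rewrite Rmult_0_l, !rpow_0; ring.
  - rewrite Rmult_0_l, !rpow_0; ring.
Qed.

Lemma rpow_rpow x a b : rpow (rpow x a) b = rpow x (a * b).
Proof.
  destruct (Rle_dec x 0).
  - unfold rpow at 2 3. destruct (Rle_dec x 0); [apply rpow_0|lra].
  - rewrite (rpow_pos x), (rpow_pos x), rpow_pos by (try apply exp_pos; lra).
    apply Rpower_mult.
Qed.

Lemma rpow_plus x a b : rpow x a * rpow x b = rpow x (a + b).
Proof.
  destruct (Rle_dec x 0).
  - unfold rpow. destruct (Rle_dec x 0); lra.
  - rewrite !rpow_pos by lra. symmetry; apply Rpower_plus.
Qed.

Lemma rpow_1 x : 0 <= x -> rpow x 1 = x.
Proof. intros [H|<-]; [|apply rpow_0]. rewrite rpow_pos; auto. apply Rpower_1; auto. Qed.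

Lemma rpow_base1 q : rpow 1 q = 1.
Proof. rewrite rpow_pos by lra. unfold Rpower. rewrite ln_1, Rmult_0_r. apply exp_0. Qed.

Lemma rpow_root x q : 0 < q -> 0 <= x -> rpow (rpow x (1 / q)) q = x.
Proof.
  intros. rewrite rpow_rpow. replace (1 / q * q) with 1 by (field; lra). apply rpow_1; auto.
Qed.

Lemma rpow_le_root x y q : 0 < q -> 0 <= y -> rpow x q <= y -> x <= rpow y (1 / q).
Proof.
  intros. apply (rpow_le_inv _ _ q); auto. apply rpow_ge0. rewrite rpow_root; auto.
Qed.

(** Lets errors linear in delta be absorbed into delta^(1/q), the scale of the midpoint
    estimates. *)
Lemma rpow_small_ge x q : 1 <= q -> 0 <= x <= 1 -> x <= rpow x (1 / q).
Proof.
  intros Hq [[H|<-] H']; [|rewrite rpow_0; lra].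
  assert (H1 : 0 < / q <= 1).
  { split; [apply Rinv_0_lt_compat; lra|]. rewrite <- Rinv_1. apply Rinv_le_contravar; lra. }
  rewrite rpow_pos by auto. rewrite <- (exp_ln x) at 1 by auto.
  assert (Hl : ln x <= 0).
  { rewrite <- ln_1. destruct H'; [left; apply ln_increasing; auto| subst; lra]. }
  assert (ln x <= 1 / q * ln x) by (unfold Rdiv; rewrite Rmult_1_l; nra).
  unfold Rpower. destruct H0 as [H0|H0]; [left; apply exp_increasing; auto|rewrite <- H0; lra].
Qed.

Lemma rpow_1plus_ge q u : 1 <= q -> 0 <= u -> 1 + u <= rpow (1 + u) q.
Proof.
  intros. rewrite rpow_pos by lra. rewrite <- (Rpower_1 (1 + u)) at 1 by lra.
  destruct (Req_dec u 0) as [->|].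
  - rewrite Rplus_0_r. unfold Rpower. rewrite ln_1, !Rmult_0_r. lra.
  - destruct H; [left; apply Rpower_lt; lra|subst; lra].
Qed.

Lemma exp_sub1_le s : exp s - 1 <= s * exp s.
Proof.
  pose proof (exp_ineq1_le (- s)). pose proof (exp_pos s).
  assert (exp s * exp (- s) = 1) by (rewrite <- exp_plus, Rplus_opp_r; apply exp_0). nra.
Qed.

Lemma ln_le_sub1 x : 0 < x -> ln x <= x - 1.
Proof.
  intros H. pose proof (exp_ineq1_le (ln x)). rewrite exp_ln in H0; auto. lra.
Qed.

Lemma exp_le x y : x <= y -> exp x <= exp y.
Proof. intros [H| ->]; [left; apply exp_increasing; auto|lra]. Qed.

(** Follows from ln (1 + s) <= s and exp s - 1 <= s exp s, the last factor being at most exp (q C)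
    on the range considered. *)
Lemma rpow_1plus_le C q : 0 <= C -> 0 < q ->
  exists K, 0 < K /\ forall u, 0 <= u <= 1 -> rpow (1 + C * u) q <= 1 + K * u.
Proof.
  intros HC Hq. exists (q * C * exp (q * C) + 1). pose proof (exp_pos (q * C)).
  assert (0 <= q * C) by nra. split; [nra|].
  intros u Hu. assert (0 <= C * u) by nra. rewrite rpow_pos by lra. unfold Rpower.
  assert (H2 : ln (1 + C * u) <= C * u) by (pose proof (ln_le_sub1 (1 + C * u)); lra).
  assert (H3 : exp (q * ln (1 + C * u)) <= exp (q * (C * u))) by (apply exp_le; nra).
  pose proof (exp_sub1_le (q * (C * u))).
  assert (exp (q * (C * u)) <= exp (q * C)).
  { apply exp_le. apply Rmult_le_compat_l; nra. }
  assert (q * (C * u) * exp (q * (C * u)) <= q * (C * u) * exp (q * C)) by (apply Rmult_le_compat_l; nra).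
  nra.
Qed.

(** On [0, 1/2] one has ln (1 - u) >= -2u, from ln y <= y - 1 at y = 1/(1 - u); then exp s >= 1 +
    s. *)
Lemma rpow_1minus_ge q u : 0 < q -> 0 <= u <= 1 / 2 -> 1 - 2 * q * u <= rpow (1 - u) q.
Proof.
  intros Hq Hu. rewrite rpow_pos by lra. unfold Rpower.
  assert (H : - (2 * u) <= ln (1 - u)).
  { pose proof (ln_le_sub1 (/ (1 - u))). rewrite ln_Rinv in H by lra.
    assert (0 < / (1 - u)) by (apply Rinv_0_lt_compat; lra).
    assert (/ (1 - u) - 1 <= 2 * u).
    { apply (Rmult_le_reg_r (1 - u)); [lra|]. rewrite Rmult_minus_distr_r, Rinv_l by lra. nra. }
    lra. }
  pose proof (exp_ineq1_le (q * ln (1 - u))). nra.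
Qed.

(** * Zorn's lemma, Hahn-Banach and ultrafilters *)

(** Zorn's lemma is applied to the sets A such that [P] holds of the union of [A0] and A. The seed
    is thus kept at every stage, and adding [A0] to a chain makes it nonempty. *)
Lemma zorn_inclusion {T : Type} (P : (T -> Prop) -> Prop) (A0 : T -> Prop) :
  P A0 ->
  (forall F : (T -> Prop) -> Prop, (exists A, F A) -> (forall A, F A -> P A) ->
     (forall A B, F A -> F B -> (forall x, A x -> B x) \/ (forall x, B x -> A x)) ->
     P (fun x => exists A, F A /\ A x)) ->
  exists A, P A /\ (forall x, A0 x -> A x) /\
    forall B, P B -> (forall x, A x -> B x) -> forall x, B x -> A x.
Proof.
  intros H0 Hc.
  destruct (@classical_sets.Zorn_bigcup T (fun A => P (fun x => A0 x \/ A x))) as [A [HA Hmax]].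
  - intros F HF Ht.
    set (F' := fun Y : T -> Prop => Y = A0 \/ exists X, F X /\ Y = (fun x => A0 x \/ X x)).
    replace (fun x => A0 x \/ classical_sets.bigcup F (fun X => X) x)
      with (fun x => exists Y, F' Y /\ Y x).
    + apply Hc.
      * exists A0; left; auto.
      * intros Y [->|[X [HX ->]]]; auto.
      * intros Y Z [->|[X [HX ->]]] [->|[X' [HX' ->]]]; auto.
        destruct (Ht X X' HX HX') as [H|H]; [left|right]; intros x [h|h]; auto; right; apply H; auto.
    + apply functional_extensionality; intros x. apply propositional_extensionality; split.
      * intros [Y [[->|[X [HX ->]]] h]]; auto. destruct h; auto. right; exists X; auto.
      * intros [h|[X HX h]]; [exists A0; split; [left|]; auto|].
        exists (fun x => A0 x \/ X x). split; [right; exists X; auto|auto].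
  - exists (fun x => A0 x \/ A x). split; [exact HA|]. split; [auto|].
    intros B HB HAB x HBx. apply NNPP; intros Hn.
    apply (Hmax B).
    + split; [intros y Hy; apply HAB; auto|]. intros H. apply Hn. right. apply H; auto.
    + replace (fun x => A0 x \/ B x) with B; auto.
      apply functional_extensionality; intros y. apply propositional_extensionality; split; auto.
      intros [h|h]; auto.
Qed.

Section HahnBanach.
Context {Z : Banach} (d : Z -> R).
Hypothesis d_add : forall x y, d (vadd x y) <= d x + d y.
Hypothesis d_scal : forall a x, d (vscal a x) = Rabs a * d x.

(** Partial linear functionals are encoded by their graphs, so that extension is inclusion.
    Domination by [d] forces single-valuedness: the difference of two values at one point is a value
    at zero, hence at most d 0 = 0. *)
Let dominated_graph (G : Z * R -> Prop) : Prop :=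
  G (vzero, 0) /\ (forall x r y s, G (x, r) -> G (y, s) -> G (vadd x y, r + s)) /\
  (forall a x r, G (x, r) -> G (vscal a x, a * r)) /\ (forall x r, G (x, r) -> r <= d x).

Lemma seminorm_zero : d vzero = 0.
Proof. rewrite <- (vscal0 vzero), d_scal, Rabs_R0. ring. Qed.

Lemma seminorm_ge0 x : 0 <= d x.
Proof.
  pose proof (d_add x (vscal (-1) x)) as H. rewrite d_scal, Rabs_left in H by lra.
  replace (vadd x (vscal (-1) x)) with (vzero : Z) in H by vlin. rewrite seminorm_zero in H. lra.
Qed.

Lemma dominated_graph_extend G x0 : dominated_graph G ->
  exists G', dominated_graph G' /\ (forall y, G y -> G' y) /\ exists c, G' (x0, c).
Proof.
  intros (G0 & Ga & Gs & Gd).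
  (* An admissible value at [x0] lies above all s - d (y - x0) and below all d (x + x0) - r.
     Subadditivity orders the two families, and c is the supremum of the first. *)
  assert (Hc : exists c, (forall y s, G (y, s) -> s - d (vsub y x0) <= c) /\
                         (forall x r, G (x, r) -> c <= d (vadd x x0) - r)).
  { destruct (completeness (fun t => exists y s, G (y, s) /\ t = s - d (vsub y x0))) as [c [Hc1 Hc2]].
    - exists (d (vadd vzero x0) - 0). intros t (y & s & H & ->).
      pose proof (Gd _ _ (Ga _ _ _ _ G0 H)) as H1.
      pose proof (d_add (vadd vzero x0) (vsub y x0)) as H2.
      replace (vadd (vadd vzero x0) (vsub y x0)) with (vadd vzero y) in H2 by vlin. lra.
    - exists (0 - d (vsub vzero x0)), vzero, 0; auto.
    - exists c; split.
      + intros y s H. apply Hc1. exists y, s; auto.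
      + intros x r H. apply Hc2. intros t (y & s & H' & ->).
        pose proof (Gd _ _ (Ga _ _ _ _ H H')) as H1.
        pose proof (d_add (vadd x x0) (vsub y x0)) as H2.
        replace (vadd (vadd x x0) (vsub y x0)) with (vadd x y) in H2 by vlin. lra. }
  destruct Hc as [c [Hc1 Hc2]].
  exists (fun p => exists x r t, G (x, r) /\ p = (vadd x (vscal t x0), r + t * c)).
  split; [|split].
  - split; [|split; [|split]].
    + exists vzero, 0, 0. split; auto. f_equal; [vlin|ring].
    + intros x r y s (x1 & r1 & t1 & H1 & E1) (x2 & r2 & t2 & H2 & E2).
      injection E1; injection E2; intros; subst.
      exists (vadd x1 x2), (r1 + r2), (t1 + t2). split; auto. f_equal; [vlin|ring].
    + intros a x r (x1 & r1 & t1 & H1 & E1). injection E1; intros; subst.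
      exists (vscal a x1), (a * r1), (a * t1). split; auto. f_equal; [vlin|ring].
    + intros x r (x1 & r1 & t & H1 & E1). injection E1; intros; subst. clear E1.
      destruct (Rtotal_order t 0) as [Ht|[->|Ht]].
      * assert (0 < / - t) by (apply Rinv_0_lt_compat; lra).
        pose proof (Hc1 _ _ (Gs (/ - t) _ _ H1)) as H2.
        replace (vadd x1 (vscal t x0)) with (vscal (- t) (vsub (vscal (/ - t) x1) x0)).
        2:{ vlin_goals; field; lra. }
        rewrite d_scal, Rabs_pos_eq by lra.
        assert (r1 = - t * (/ - t * r1)) by (field; lra).
        set (u := / - t * r1) in *. nra.
      * replace (vadd x1 (vscal 0 x0)) with x1 by vlin. apply Gd in H1. lra.
      * assert (0 < / t) by (apply Rinv_0_lt_compat; lra).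
        pose proof (Hc2 _ _ (Gs (/ t) _ _ H1)) as H2.
        replace (vadd x1 (vscal t x0)) with (vscal t (vadd (vscal (/ t) x1) x0)).
        2:{ vlin_goals; field; lra. }
        rewrite d_scal, Rabs_pos_eq by lra.
        assert (r1 = t * (/ t * r1)) by (field; lra).
        set (u := / t * r1) in *. nra.
  - intros [y s] H. exists y, s, 0. split; auto. f_equal; [vlin|ring].
  - exists c, vzero, 0, 1. split; auto. f_equal; [vlin|ring].
Qed.

(** The seminorm form covers both the norm and the distance to a subspace. Zorn starts from the line
    through [v]; by the one-step extension a maximal graph is defined everywhere. *)
Theorem hahn_banach (v : Z) :
  exists f, is_linear_fun f /\ (forall x, Rabs (f x) <= d x) /\ f v = d v.
Proof.
  destruct (zorn_inclusion dominated_graph (fun p => exists a, p = (vscal a v, a * d v)))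
    as (G & HG & HvG & Hmax).
  - split; [|split; [|split]].
    + exists 0. f_equal; [vlin|ring].
    + intros x r y s (a & E1) (b & E2). injection E1; injection E2; intros; subst.
      exists (a + b). f_equal; [vlin|ring].
    + intros a x r (b & E1). injection E1; intros; subst. exists (a * b). f_equal; [vlin|ring].
    + intros x r (b & E1). injection E1; intros; subst. rewrite d_scal.
      apply Rmult_le_compat_r; [apply seminorm_ge0|apply Rle_abs].
  - intros F [A FA] HF Hch. split; [|split; [|split]].
    + exists A. split; auto. apply HF; auto.
    + intros x r y s (A1 & F1 & H1) (A2 & F2 & H2).
      destruct (Hch _ _ F1 F2) as [h|h]; [exists A2|exists A1]; split; auto;
        apply HF; auto.
    + intros a x r (A1 & F1 & H1). exists A1; split; auto. apply HF; auto.
    + intros x r (A1 & F1 & H1). apply (HF _ F1); auto.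
  - assert (Hdom : forall x, exists r, G (x, r)).
    { intros x. destruct (dominated_graph_extend G x HG) as (G' & H1 & H2 & c & H3).
      exists c. apply (Hmax G'); auto. }
    destruct HG as (G0 & Ga & Gs & Gd).
    assert (Huniq : forall x r s, G (x, r) -> G (x, s) -> r = s).
    { assert (forall x r s, G (x, r) -> G (x, s) -> r <= s).
      { intros x r s H1 H2. pose proof (Gd _ _ (Ga _ _ _ _ H1 (Gs (-1) _ _ H2))) as H.
        replace (vadd x (vscal (-1) x)) with (vzero : Z) in H by vlin. rewrite seminorm_zero in H. lra. }
      intros; apply Rle_antisym; eauto. }
    set (f := fun x => proj1_sig (constructive_indefinite_description _ (Hdom x))).
    assert (Hf : forall x, G (x, f x)).
    { intros x. unfold f. destruct (constructive_indefinite_description _ (Hdom x)); auto. }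
    assert (Hl : is_linear_fun f).
    { split; intros.
      - apply (Huniq (vadd x y)); auto.
      - apply (Huniq (vscal a x)); auto. }
    exists f. split; [auto|split].
    + intros x. apply Rabs_le. split; [|apply Gd; auto].
      pose proof (Gd _ _ (Hf (vopp x))) as H. rewrite lin_opp in H by auto.
      rewrite vopp_scal, d_scal, Rabs_left in H by lra. lra.
    + apply (Huniq v); auto. apply HvG. exists 1. f_equal; [vlin|ring].
Qed.

End HahnBanach.

Lemma norming_functional {Z : Banach} (v : Z) :
  exists f, in_dual f /\ (forall x, Rabs (f x) <= vnorm x) /\ f v = vnorm v.
Proof.
  destruct (hahn_banach (@vnorm Z) (vnorm_tri Z) (vnormZ Z) v) as (f & H1 & H2 & H3).
  exists f. split; auto. split; auto. exists 1. intros x; rewrite Rmult_1_l; auto.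
Qed.

Record ultrafilter {I : Type} (V : (I -> Prop) -> Prop) : Prop := {
  uf_and : forall A B : I -> Prop, V A -> V B -> V (fun i => A i /\ B i);
  uf_mono : forall A B : I -> Prop, V A -> (forall i, A i -> B i) -> V B;
  uf_false : ~ V (fun _ => False);
  uf_em : forall A : I -> Prop, V A \/ V (fun i => ~ A i)
}.

Section Ultrafilter.
Context {I : Type} {V : (I -> Prop) -> Prop} (HV : ultrafilter V).

Lemma uf_all (A : I -> Prop) : (forall i, A i) -> V A.
Proof.
  intros H. destruct (uf_em _ HV A); auto. apply (uf_mono _ HV _ _ H0). auto.
Qed.

Lemma uf_and_mono (A B C : I -> Prop) : V A -> V B -> (forall i, A i -> B i -> C i) -> V C.
Proof.
  intros H1 H2 H. apply (uf_mono _ HV _ _ (uf_and _ HV _ _ H1 H2)). intros i [h1 h2]; auto.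
Qed.

Lemma uf_ex (A : I -> Prop) : V A -> exists i, A i.
Proof.
  intros H. apply NNPP; intros Hn. apply (uf_false _ HV), (uf_mono _ HV _ _ H).
  intros i Hi; apply Hn; exists i; auto.
Qed.

Lemma uf_const (P : Prop) : V (fun _ => P) -> P.
Proof. intros H. destruct (uf_ex _ H); auto. Qed.

Lemma ulim_exists (g : I -> R) M : V (fun i => Rabs (g i) <= M) ->
  exists L, Rabs L <= M /\ forall eps, 0 < eps -> V (fun i => Rabs (g i - L) < eps).
Proof.
  intros HM.
  (* The limit is the supremum of the levels r with r <= g i for V-almost all i. *)
  destruct (completeness (fun r => V (fun i => r <= g i))) as [L [H1 H2]].
  - exists M. intros r Hr. apply uf_const. apply (uf_and_mono _ _ _ HM Hr).
    intros i h1 h2. pose proof (Rle_abs (g i)); lra.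
  - exists (- M). apply (uf_mono _ HV _ _ HM). intros i h.
    pose proof (Rle_abs (- g i)). rewrite Rabs_Ropp in H. lra.
  - assert (HL : forall eps, 0 < eps -> V (fun i => Rabs (g i - L) < eps)).
    { intros eps He.
      assert (Ha : V (fun i => L - eps < g i)).
      { destruct (uf_em _ HV (fun i => L - eps < g i)); auto. exfalso.
        assert (L <= L - eps); [|lra]. apply H2. intros r Hr.
        apply uf_const. apply (uf_and_mono _ _ _ H Hr). intros; lra. }
      assert (Hb : V (fun i => g i < L + eps)).
      { destruct (uf_em _ HV (fun i => g i < L + eps)); auto. exfalso.
        assert (L + eps <= L); [|lra]. apply H1.
        apply (uf_mono _ HV _ _ H). intros; lra. }
      apply (uf_and_mono _ _ _ Ha Hb). intros i h1 h2. apply Rabs_def1; lra. }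
    exists L; split; auto.
    apply Rnot_lt_le; intros Hlt.
    destruct (uf_ex _ (uf_and _ HV _ _ HM (HL (Rabs L - M) ltac:(lra)))) as [i [h1 h2]].
    pose proof (Rabs_triang_inv L (g i)). rewrite Rabs_minus_sym in h2. lra.
Qed.

End Ultrafilter.

Lemma free_ultrafilter_exists :
  exists U : (nat -> Prop) -> Prop, ultrafilter U /\ forall m, U (fun n => (m <= n)%nat).
Proof.
  set (filt := fun F : (nat -> Prop) -> Prop =>
    (forall A B : nat -> Prop, F A -> F B -> F (fun i => A i /\ B i)) /\
    (forall A B : nat -> Prop, F A -> (forall i, A i -> B i) -> F B) /\ ~ F (fun _ => False)).
  destruct (zorn_inclusion filt (fun A => exists m, forall n, (m <= n)%nat -> A n))
    as (U & (Ua & Um & Uf) & HU & Hmax).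
  - split; [|split].
    + intros A B [m Hm] [m' Hm']. exists (m + m')%nat. intros n Hn; split; [apply Hm|apply Hm']; lia.
    + intros A B [m Hm] H. exists m; auto.
    + intros [m Hm]. apply (Hm m); lia.
  - intros F [F0 HF0] HF Hch. split; [|split].
    + intros A B (F1 & H1 & HA) (F2 & H2 & HB).
      destruct (Hch _ _ H1 H2) as [h|h]; [exists F2|exists F1]; split; auto; apply HF; auto.
    + intros A B (F1 & H1 & HA) h. exists F1; split; auto. destruct (HF _ H1) as (_ & Hm & _). eauto.
    + intros (F1 & H1 & HA). apply (HF _ H1); auto.
  - exists U. split; [|intros m; apply HU; exists m; auto].
    assert (UT : U (fun _ => True)) by (apply HU; exists 0%nat; auto).
    split; auto. intros A. destruct (classic (U A)) as [h|h]; [auto|right].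
    (* If A is not in U, the filter generated by U and the complement of A is proper; maximality
       then puts this complement in U. *)
    apply (Hmax (fun C => exists B, U B /\ forall i, B i -> ~ A i -> C i)).
    + split; [|split].
      * intros B C (B1 & H1 & H2) (B2 & H3 & H4). exists (fun i => B1 i /\ B2 i).
        split; auto. intros i [h1 h2] h3; auto.
      * intros B C (B1 & H1 & H2) H. exists B1; eauto.
      * intros (B1 & H1 & H2). apply h, (Um _ _ H1). intros i h1. apply NNPP; eauto.
    + intros B HB. exists B; auto.
    + exists (fun _ => True). auto.
Qed.

(** The Fubini power of U: the first entry is the outermost quantifier, so each entry may be taken
    large in terms of those before it. *)
Fixpoint uf_power (U : (nat -> Prop) -> Prop) (k : nat) : (list nat -> Prop) -> Prop :=
  match k with
  | O => fun A => A nil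
  | S k' => fun A => U (fun n => uf_power U k' (fun l => A (n :: l)))
  end.

Lemma uf_power_ultra U k : ultrafilter U -> ultrafilter (uf_power U k).
Proof.
  intros HU. induction k as [|k IH]; simpl.
  - split; auto. intros A; apply classic.
  - split.
    + intros A B HA HB. apply (uf_and_mono HU _ _ _ HA HB). intros n. apply (uf_and _ IH).
    + intros A B HA H. apply (uf_mono _ HU _ _ HA). intros n Hn. apply (uf_mono _ IH _ _ Hn); auto.
    + intros H. apply (uf_false _ HU), (uf_mono _ HU _ _ H). intros n. apply (uf_false _ IH).
    + intros A. destruct (uf_em _ HU (fun n => uf_power U k (fun l => A (n :: l)))); auto.
      right. apply (uf_mono _ HU _ _ H). intros n Hn.
      destruct (uf_em _ IH (fun l => A (n :: l))); tauto.
Qed.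

Fixpoint increasing_from (m : nat) (l : list nat) : Prop :=
  match l with
  | nil => True
  | n :: l' => (m <= n)%nat /\ increasing_from (S n) l'
  end.

Lemma uf_power_forall U (HU : ultrafilter U) (A : nat -> Prop) k :
  U A -> uf_power U k (Forall A).
Proof.
  intros HA. induction k; simpl; auto.
  apply (uf_mono _ HU _ _ HA). intros n Hn. apply (uf_mono _ (uf_power_ultra U k HU) _ _ IHk).
  auto.
Qed.

Lemma uf_power_length U (HU : ultrafilter U) k : uf_power U k (fun l => length l = k).
Proof.
  induction k; simpl; auto.
  apply (uf_all HU). intros n. apply (uf_mono _ (uf_power_ultra U k HU) _ _ IHk); auto.
Qed.

Lemma uf_power_increasing U (HU : ultrafilter U) (Hfree : forall m, U (fun n => (m <= n)%nat)) k m :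
  uf_power U k (increasing_from m).
Proof.
  revert m. induction k; simpl; intros m; auto.
  apply (uf_mono _ HU _ _ (Hfree m)). intros n Hn.
  apply (uf_mono _ (uf_power_ultra U k HU) _ _ (IHk (S n))). auto.
Qed.

Lemma increasing_from_nth m l : increasing_from m l ->
  (forall i, (S i < length l)%nat -> (nth i l 0 < nth (S i) l 0)%nat) /\
  ((0 < length l)%nat -> (m <= nth 0 l 0)%nat).
Proof.
  revert m. induction l as [|n l IH]; simpl; intros m H.
  - split; intros; lia.
  - destruct H as [H1 H2]. destruct (IH _ H2) as [H3 H4]. split; auto.
    intros [|i] Hi; [apply H4; lia|apply H3; lia].
Qed.

(** * Finite-codimensional subspaces and weak limits *)

(** Approximate membership: the subspaces are not assumed closed, and weak convergence only brings
    vectors close to them. *)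
Definition near {Z : Banach} (E : Z -> Prop) (s : R) (x : Z) : Prop :=
  exists v, E v /\ vnorm (vsub x v) < s.

Lemma finite_codim_full {Z : Banach} : finite_codim_subspace (fun _ : Z => True).
Proof.
  repeat split. exists 0%nat, (fun _ => vzero). intros z. exists z, (fun _ => 0).
  split; auto. simpl. now rewrite vadd0.
Qed.

(** Puts smoothness in additive form, ready for iteration: a step of size [lam] in a suitable
    direction raises the r-th power of the norm by at most B lam^r, whatever the base point. *)
Lemma smooth_step (Z : Banach) (r : R) : 0 < r -> asymp_unif_smooth Z r ->
  exists B, 0 < B /\ forall (z : Z) lam, 0 < lam ->
    exists E s, finite_codim_subspace E /\ 0 < s /\
      forall h, vnorm h <= lam -> near E s h ->
        rpow (vnorm (vadd z h)) r <= rpow (vnorm z) r + B * rpow lam r.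
Proof.
  intros Hr [C0 HC0]. set (C := Rabs C0).
  assert (HC : 0 <= C) by apply Rabs_pos.
  destruct (rpow_1plus_le (C + 2) r ltac:(lra) Hr) as (K & HK & HK1).
  pose proof (rpow_gt0 3 r ltac:(lra)) as H3. pose proof (rpow_gt0 2 r ltac:(lra)) as H2.
  (* The first summand pays for ||z|| <= 2 lam, where the triangle inequality suffices; the second
     comes from the asymptotic estimate. *)
  exists (rpow 3 r + K * rpow 2 r). split; [nra|]. intros z lam Hl.
  pose proof (rpow_gt0 lam r Hl) as Hlr. pose proof (rpow_ge0 (vnorm z) r) as Hzr.
  destruct (Rle_dec (vnorm z) (2 * lam)) as [Hz|Hz].
  - exists (fun _ => True), 1. split; [apply finite_codim_full|split; [lra|]].
    intros h Hh _.
    assert (H : rpow (vnorm (vadd z h)) r <= rpow (3 * lam) r).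
    { apply rpow_le; [lra|]. pose proof (vnorm_tri _ z h); lra. }
    rewrite rpow_mult in H by lra. assert (0 <= K * rpow 2 r * rpow lam r) by (repeat apply Rmult_le_pos; lra). lra.
  - assert (Hz0 : 0 < vnorm z) by lra.
    assert (Hzn : z <> vzero) by (intros ->; rewrite vnorm0 in Hz0; lra).
    (* A vector v of E within [lam] of h has norm at most 2 lam, which fixes the scale t. Smoothness
       is used with error T = t^r, and replacing v by h costs another T ||z||: hence the constant C
       + 2. *)
    set (t := 2 * lam / vnorm z).
    assert (Ht : 0 < t <= 1).
    { split; [apply Rdiv_lt_0_compat; lra|].
      apply (Rmult_le_reg_r (vnorm z)); auto. unfold t. field_simplify; lra. }
    assert (Htz : t * vnorm z = 2 * lam) by (unfold t; field; lra).
    set (T := rpow t r). assert (HT : 0 < T) by (apply rpow_gt0; lra).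
    assert (HT1 : T <= 1) by (unfold T; rewrite <- (rpow_base1 r); apply rpow_le; lra).
    set (z' := vscal (/ vnorm z) z).
    destruct (HC0 t ltac:(lra) z' (vnorm_unit z Hzn) T HT) as (E & HE & HEt).
    exists E, (Rmin lam (vnorm z * T)). split; [auto|split].
    { apply Rmin_glb_lt; nra. }
    intros h Hh (v & Hv & Hhv).
    pose proof (Rmin_l lam (vnorm z * T)). pose proof (Rmin_r lam (vnorm z * T)).
    assert (Hvn : vnorm v <= 2 * lam).
    { pose proof (vnorm_le_add v h (vsub v h) ltac:(vlin)). rewrite (vsub_sym v h) in H1. lra. }
    assert (Hzv : vnorm (vadd z v) <= vnorm z * (1 + (C + 1) * T)).
    { destruct (classic (v = vzero)) as [->|Hv0].
      - rewrite vadd0. assert (0 <= vnorm z * ((C + 1) * T)) by (apply Rmult_le_pos; nra). lra.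
      - pose proof (vnorm_pos v Hv0) as Hvp.
        set (h' := vscal (/ vnorm v) v).
        assert (Hh' : E h') by (apply HE; auto).
        specialize (HEt h' Hh' (vnorm_unit v Hv0)). fold T in HEt.
        assert (C0 * T <= C * T) by (apply Rmult_le_compat_r; [lra|apply Rle_abs]).
        (* Convexity reduces v to length 2 lam: z + v is the combination, with weights 1 - a and a,
           of z and ||z|| (z' + t h'). *)
        set (a := vnorm v / (2 * lam)).
        assert (Ha : 0 <= a <= 1).
        { split; [apply Rlt_le, Rdiv_lt_0_compat; lra|].
          apply (Rmult_le_reg_r (2 * lam)); [lra|]. unfold a. field_simplify; lra. }
        assert (Hat : a * t * vnorm z = vnorm v).
        { rewrite Rmult_assoc, Htz. unfold a. field; lra. }
        pose proof (vnorm_le_add (vadd z v) (vscal (1 - a) z)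
          (vscal (a * vnorm z) (vadd z' (vscal t h')))) as Hadd.
        rewrite !vnormZ, !Rabs_pos_eq in Hadd by nra.
        assert (Hn : vnorm (vadd z' (vscal t h')) <= 1 + (C + 1) * T) by lra.
        assert (vadd z v = vadd (vscal (1 - a) z) (vscal (a * vnorm z) (vadd z' (vscal t h')))).
        { unfold z', h'. vlin_goals.
          - replace (a * vnorm z * (/ vnorm z * 0 + t * (/ vnorm v * 1)))
              with (a * t * vnorm z * / vnorm v) by ring.
            rewrite Hat. field; lra.
          - field; lra. }
        specialize (Hadd H4).
        assert (a * vnorm z * vnorm (vadd z' (vscal t h')) <= a * vnorm z * (1 + (C + 1) * T)).
        { apply Rmult_le_compat_l; [nra|auto]. }
        assert (0 <= (1 - a) * (vnorm z * ((C + 1) * T))).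
        { apply Rmult_le_pos; [lra|]. apply Rmult_le_pos; nra. }
        nra. }
    assert (Hzh : vnorm (vadd z h) <= vnorm z * (1 + (C + 2) * T)).
    { pose proof (vnorm_le_add (vadd z h) (vadd z v) (vsub h v) ltac:(vlin)). nra. }
    apply (rpow_le _ _ r ltac:(lra)) in Hzh. rewrite rpow_mult in Hzh by nra.
    pose proof (HK1 T ltac:(lra)) as HKT.
    assert (Hzt : rpow (vnorm z) r * T = rpow 2 r * rpow lam r).
    { unfold T. rewrite <- rpow_mult, <- rpow_mult, <- Htz by lra. f_equal; ring. }
    assert (rpow (vnorm z) r * rpow (1 + (C + 2) * T) r <= rpow (vnorm z) r * (1 + K * T))
      by (apply Rmult_le_compat_l; auto).
    assert (0 <= rpow 3 r * rpow lam r) by nra.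
    assert (rpow (vnorm z) r * (1 + K * T) = rpow (vnorm z) r + K * (rpow 2 r * rpow lam r)) by (rewrite <- Hzt; ring).
    lra.
Qed.

Definition subspace {Z : Banach} (E : Z -> Prop) : Prop :=
  E vzero /\ (forall x y, E x -> E y -> E (vadd x y)) /\ (forall a x, E x -> E (vscal a x)).

Lemma subspace_sub {Z : Banach} (E : Z -> Prop) x y : subspace E -> E x -> E y -> E (vsub x y).
Proof.
  intros (_ & Ha & Hs) Hx Hy. unfold vsub. rewrite vopp_scal. auto.
Qed.

(** Compactness of bounded sets in the quotient by E, along V and up to s. By induction E is first
    enlarged by the last complementary vector, whose coefficient is then replaced by its
    ultralimit. *)
Lemma finite_codim_totally_bounded_aux {Z : Banach} {I : Type} {V : (I -> Prop) -> Prop}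
  (HV : ultrafilter V) (n : nat) : forall (E : Z -> Prop) (w : nat -> Z) (g : I -> Z) M s,
  subspace E ->
  (forall z, exists e (c : nat -> R), E e /\ z = vadd e (vsum n (fun i => vscal (c i) (w i)))) ->
  V (fun i => vnorm (g i) <= M) -> 0 < s ->
  exists z0, V (fun i => near E s (vsub (g i) z0)).
Proof.
  induction n as [|n IH]; intros E w g M s HE Hw HM Hs.
  - exists vzero. apply (uf_all HV). intros i.
    exists (vsub (g i) vzero). split.
    + destruct (Hw (vsub (g i) vzero)) as (e & c & He & ->). simpl. now rewrite vadd0.
    + replace (vsub (vsub (g i) vzero) (vsub (g i) vzero)) with (vzero : Z) by vlin.
      now rewrite vnorm0.
  - set (E' := fun x => exists e c, E e /\ x = vadd e (vscal c (w n))).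
    pose proof HE as (HE0 & HEa & HEs).
    destruct (IH E' w g M (s / 2)) as [z0 Hz0]; auto; [| |lra|].
    { split; [|split].
      - exists vzero, 0; split; auto. vlin.
      - intros x y (e1 & c1 & H1 & ->) (e2 & c2 & H2 & ->).
        exists (vadd e1 e2), (c1 + c2); split; auto. vlin.
      - intros a x (e1 & c1 & H1 & ->). exists (vscal a e1), (a * c1); split; auto. vlin. }
    { intros z. destruct (Hw z) as (e & c & He & Hz). simpl in Hz.
      exists (vadd e (vscal (c n) (w n))), c. split.
      - exists e, (c n); auto.
      - rewrite Hz. vlin. }
    (* If w n is in the closure of E, closeness to E' gives closeness to E. Otherwise w n is at
       distance at least some t > 0 from E, which bounds the coefficients. *)
    destruct (classic (forall t, 0 < t -> near E t (w n))) as [Hd|Hd].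
    + exists z0. apply (uf_mono _ HV _ _ Hz0). intros i (v & (e & c & He & ->) & Hv).
      destruct (Hd (s / (2 * (Rabs c + 1)))) as (e' & He' & Hn).
      { apply Rdiv_lt_0_compat; auto. pose proof (Rabs_pos c); lra. }
      exists (vadd e (vscal c e')). split; auto.
      pose proof (vnorm_le_add (vsub (vsub (g i) z0) (vadd e (vscal c e')))
        (vsub (vsub (g i) z0) (vadd e (vscal c (w n)))) (vscal c (vsub (w n) e')) ltac:(vlin)) as H.
      rewrite vnormZ in H.
      assert (Rabs c * vnorm (vsub (w n) e') <= s / 2); [|lra].
      pose proof (Rabs_pos c).
      apply Rle_trans with ((Rabs c + 1) * (s / (2 * (Rabs c + 1)))).
      * apply Rmult_le_compat; auto using vnorm_ge0; lra.
      * right; field; lra.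
    + apply not_all_ex_not in Hd. destruct Hd as [t Hd].
      apply imply_to_and in Hd. destruct Hd as [Ht Hd].
      assert (Hdist : forall e c, E e -> Rabs c * t <= vnorm (vadd e (vscal c (w n)))).
      { intros e c He. destruct (Req_dec c 0) as [->|Hc].
        - rewrite Rabs_R0, Rmult_0_l. apply vnorm_ge0.
        - assert (Hp : 0 < Rabs c) by (apply Rabs_pos_lt; auto).
          replace (vadd e (vscal c (w n))) with (vscal c (vsub (w n) (vscal (- / c) e))).
          2:{ vlin_goals; field; auto. }
          rewrite vnormZ. apply Rmult_le_compat_l; [lra|].
          apply Rnot_lt_le; intros Hlt. apply Hd. exists (vscal (- / c) e). split; auto. }
      destruct (choice (fun (i : I) (c : R) => near E' (s / 2) (vsub (g i) z0) ->
        exists e, E e /\ vnorm (vsub (vsub (g i) z0) (vadd e (vscal c (w n)))) < s / 2)) as [c Hc].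
      { intros i. destruct (classic (near E' (s / 2) (vsub (g i) z0))) as [h|h].
        - destruct h as (v & (e & c & He & ->) & Hv). exists c. intros _. exists e; auto.
        - exists 0; tauto. }
      set (M' := (M + vnorm z0 + s / 2) / t).
      destruct (ulim_exists HV c M') as [c0 [_ Hc0]].
      { apply (uf_and_mono HV _ _ _ Hz0 HM). intros i h1 h2.
        destruct (Hc i h1) as (e & He & Hn).
        apply (Rmult_le_reg_r t); auto.
        apply Rle_trans with (vnorm (vadd e (vscal (c i) (w n)))); auto.
        pose proof (vnorm_le_add (vadd e (vscal (c i) (w n))) (vsub (g i) z0)
          (vopp (vsub (vsub (g i) z0) (vadd e (vscal (c i) (w n))))) ltac:(vlin)) as H.
        rewrite vnorm_opp in H.
        pose proof (vnorm_le_add (vsub (g i) z0) (g i) (vopp z0) ltac:(vlin)) as H'.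
        rewrite vnorm_opp in H'. unfold M'. field_simplify; lra. }
      exists (vadd z0 (vscal c0 (w n))).
      pose proof (vnorm_ge0 (w n)) as Hwn.
      assert (Hp : 0 < s / (2 * (vnorm (w n) + 1))) by (apply Rdiv_lt_0_compat; lra).
      apply (uf_and_mono HV _ _ _ Hz0 (Hc0 _ Hp)). intros i h1 h2.
      destruct (Hc i h1) as (e & He & Hn). exists e. split; auto.
      pose proof (vnorm_le_add (vsub (vsub (g i) (vadd z0 (vscal c0 (w n)))) e)
        (vsub (vsub (g i) z0) (vadd e (vscal (c i) (w n)))) (vscal (c i - c0) (w n)) ltac:(vlin)) as H.
      rewrite vnormZ in H.
      assert (Rabs (c i - c0) * vnorm (w n) <= s / 2); [|lra].
      apply Rle_trans with ((s / (2 * (vnorm (w n) + 1))) * (vnorm (w n) + 1)).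
      * apply Rmult_le_compat; auto using Rabs_pos; lra.
      * right; field; lra.
Qed.

Lemma finite_codim_totally_bounded {Z : Banach} {I : Type} {V : (I -> Prop) -> Prop}
  (HV : ultrafilter V) (E : Z -> Prop) (g : I -> Z) M s :
  finite_codim_subspace E -> V (fun i => vnorm (g i) <= M) -> 0 < s ->
  exists z0, V (fun i => near E s (vsub (g i) z0)).
Proof.
  intros (H0 & Ha & Hs & n & w & Hw). apply (finite_codim_totally_bounded_aux HV n E w g M s); auto.
  repeat split; auto.
Qed.

Definition weak_limit {Z : Banach} {I : Type} (V : (I -> Prop) -> Prop) (g : I -> Z) (y : Z) : Prop :=
  forall f : Z -> R, in_dual f -> forall eps, 0 < eps -> V (fun i => Rabs (f (g i) - f y) < eps).

(** Hahn-Banach for the distance to E, a seminorm bounded by the norm, zero on E and at least s at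
    v. *)
Lemma subspace_separation {Z : Banach} (E : Z -> Prop) (s : R) (v : Z) :
  subspace E -> 0 < s -> ~ near E s v ->
  exists f, in_dual f /\ (forall x, E x -> f x = 0) /\ (forall x, Rabs (f x) <= vnorm x) /\ s <= f v.
Proof.
  intros HE Hs Hv. pose proof HE as (HE0 & HEa & HEs).
  assert (Hd : forall x, exists D, (forall e, E e -> D <= vnorm (vsub x e)) /\
     forall t, D < t -> near E t x).
  { intros x. destruct (completeness (fun r => exists e, E e /\ r = - vnorm (vsub x e))) as [D [H1 H2]].
    - exists 0. intros r (e & He & ->). pose proof (vnorm_ge0 (vsub x e)); lra.
    - exists (- vnorm (vsub x vzero)), vzero; auto.
    - exists (- D). split.
      + intros e He. assert (- vnorm (vsub x e) <= D) by (apply H1; exists e; auto). lra.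
      + intros t Ht. apply NNPP; intros Hn. assert (D <= - t); [|lra].
        apply H2. intros r (e & He & ->). apply Ropp_le_contravar, Rnot_lt_le.
        intros Hlt; apply Hn; exists e; auto. }
  destruct (choice _ Hd) as [d Hd']. clear Hd.
  assert (dlow : forall x D, (forall e, E e -> D <= vnorm (vsub x e)) -> D <= d x).
  { intros x D HD. apply Rnot_lt_le; intros Hlt. destruct (Hd' x) as [_ H].
    destruct (H D Hlt) as (e & He & Hn). specialize (HD e He). lra. }
  assert (dge0 : forall x, 0 <= d x) by (intros; apply dlow; intros; apply vnorm_ge0).
  assert (dle : forall x, d x <= vnorm x).
  { intros x. destruct (Hd' x) as [H _]. specialize (H vzero HE0).
    replace (vsub x vzero) with x in H by vlin. auto. }
  assert (dadd : forall x y, d (vadd x y) <= d x + d y).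
  { intros x y. apply le_epsilon; intros eps He.
    destruct (Hd' x) as [_ Hx]. destruct (Hx (d x + eps / 2) ltac:(lra)) as (e1 & He1 & Hn1).
    destruct (Hd' y) as [_ Hy]. destruct (Hy (d y + eps / 2) ltac:(lra)) as (e2 & He2 & Hn2).
    destruct (Hd' (vadd x y)) as [H _]. specialize (H (vadd e1 e2) (HEa _ _ He1 He2)).
    pose proof (vnorm_le_add (vsub (vadd x y) (vadd e1 e2)) (vsub x e1) (vsub y e2) ltac:(vlin)). lra. }
  assert (dsc : forall a x, Rabs a * d x <= d (vscal a x)).
  { intros a x. apply dlow. intros e He. destruct (Req_dec a 0) as [->|Ha].
    - rewrite Rabs_R0, Rmult_0_l. apply vnorm_ge0.
    - replace (vsub (vscal a x) e) with (vscal a (vsub x (vscal (/ a) e))) by (vlin_goals; field; auto).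
      rewrite vnormZ. apply Rmult_le_compat_l; [apply Rabs_pos|]. apply (Hd' x); auto. }
  assert (dscal : forall a x, d (vscal a x) = Rabs a * d x).
  { intros a x. apply Rle_antisym; auto. destruct (Req_dec a 0) as [->|Ha].
    - rewrite Rabs_R0, Rmult_0_l. pose proof (dle (vscal 0 x)).
      rewrite vnormZ, Rabs_R0, Rmult_0_l in H. auto.
    - pose proof (dsc (/ a) (vscal a x)) as H.
      replace (vscal (/ a) (vscal a x)) with x in H by (vlin_goals; field; auto).
      apply (Rmult_le_reg_l (Rabs (/ a))); [apply Rabs_pos_lt, Rinv_neq_0_compat; auto|].
      rewrite <- Rmult_assoc, <- Rabs_mult, Rinv_l, Rabs_R1, Rmult_1_l by auto. auto. }
  destruct (hahn_banach d dadd dscal v) as (f & Hl & Hf & Hfv).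
  exists f. split; [|split; [|split]].
  - split; auto. exists 1. intros x. rewrite Rmult_1_l. eapply Rle_trans; [apply Hf|apply dle].
  - intros x Hx. assert (d x <= 0).
    { destruct (Hd' x) as [H _]. specialize (H x Hx).
      replace (vsub x x) with (vzero : Z) in H by vlin. rewrite vnorm0 in H; auto. }
    specialize (Hf x). pose proof (Rabs_pos (f x)).
    destruct (Req_dec (f x) 0); auto. pose proof (Rabs_pos_lt _ H1). lra.
  - intros x. eapply Rle_trans; [apply Hf|apply dle].
  - rewrite Hfv. apply dlow. intros e He. apply Rnot_lt_le. intros Hlt; apply Hv; exists e; auto.
Qed.

Section WeakLimit.
Context {Z : Banach} {I : Type} {V : (I -> Prop) -> Prop} (HV : ultrafilter V).

(** Modulo E, compactness gives a limit point z0 of the g i. Were z0 - y not within s/2 of E, a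
    functional vanishing on E would be at least s/2 there, whereas the two approximations keep it
    below s/4 + s/4. *)
Lemma weak_limit_near (g : I -> Z) y M (E : Z -> Prop) s :
  weak_limit V g y -> V (fun i => vnorm (g i) <= M) -> finite_codim_subspace E -> 0 < s ->
  V (fun i => near E s (vsub (g i) y)).
Proof.
  intros Hw HM HE Hs.
  assert (HEs : subspace E) by (destruct HE as (a & b & c & _); repeat split; auto).
  destruct (finite_codim_totally_bounded HV E g M (s / 4) HE HM ltac:(lra)) as [z0 Hz0].
  assert (Hn : near E (s / 2) (vsub z0 y)).
  { apply NNPP; intros Hn.
    destruct (subspace_separation E (s / 2) (vsub z0 y) HEs ltac:(lra) Hn) as (f & Hf & HfE & Hfn & Hfv).
    destruct (uf_ex HV _ (uf_and _ HV _ _ Hz0 (Hw f Hf (s / 4) ltac:(lra)))) as [i [(v & Hv & Hvn) h2]].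
    destruct Hf as [Hl _]. rewrite lin_sub in Hfv by auto.
    pose proof (Hfn (vsub (vsub (g i) z0) v)) as H. rewrite !lin_sub, (HfE v Hv) in H by auto.
    apply Rabs_def2 in h2. assert (H' : Rabs (f (g i) - f z0 - 0) < s / 4) by lra. apply Rabs_def2 in H'. lra. }
  destruct Hn as (v & Hv & Hvn).
  apply (uf_mono _ HV _ _ Hz0). intros i (v' & Hv' & Hvn').
  exists (vadd v' v). split; [apply HEs; auto|].
  pose proof (vnorm_le_add (vsub (vsub (g i) y) (vadd v' v)) (vsub (vsub (g i) z0) v')
    (vsub (vsub z0 y) v) ltac:(vlin)). lra.
Qed.

(** Weak lower semicontinuity of the norm, tested on a functional norming y - z. *)
Lemma weak_limit_dist (g h : I -> Z) y z M :
  weak_limit V g y -> weak_limit V h z -> V (fun i => vnorm (vsub (g i) (h i)) <= M) ->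
  vnorm (vsub y z) <= M.
Proof.
  intros Hg Hh HM. destruct (norming_functional (vsub y z)) as (f & Hf & Hfn & Hfv).
  apply le_epsilon. intros eps He.
  destruct (uf_ex HV _ (uf_and _ HV _ _ HM (uf_and _ HV _ _ (Hg f Hf (eps / 2) ltac:(lra)) (Hh f Hf (eps / 2) ltac:(lra)))))
    as [i (h1 & h2 & h3)].
  destruct Hf as [Hl _]. rewrite <- Hfv, lin_sub by auto.
  pose proof (Hfn (vsub (g i) (h i))) as H. rewrite lin_sub in H by auto.
  apply Rabs_def2 in h2, h3. pose proof (Rle_abs (f (g i) - f (h i))). lra.
Qed.

(** Sending f to the limit of f (g i) along V defines a bounded linear functional on the dual, which
    reflexivity represents by a point. *)
Lemma reflexive_weak_limit (g : I -> Z) M :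
  reflexive Z -> V (fun i => vnorm (g i) <= M) -> exists y, weak_limit V g y.
Proof.
  intros Hr HM.
  assert (HL : forall f : Z -> R, exists L, in_dual f -> forall eps, 0 < eps -> V (fun i => Rabs (f (g i) - L) < eps)).
  { intros f. destruct (classic (in_dual f)) as [Hf|Hf]; [|exists 0; tauto].
    destruct (in_dual_bound f Hf) as (K & HK & HfK).
    destruct (ulim_exists HV (fun i => f (g i)) (K * M)) as [L [_ HL]]; [|exists L; auto].
    apply (uf_mono _ HV _ _ HM). intros i Hi. eapply Rle_trans; [apply HfK|].
    apply Rmult_le_compat_l; lra. }
  destruct (choice _ HL) as [Phi HPhi]. clear HL.
  assert (Huniq : forall f L, in_dual f ->
    (forall eps, 0 < eps -> V (fun i => Rabs (f (g i) - L) < eps)) -> Phi f = L).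
  { intros f L Hf HL. apply cond_eq. intros eps He.
    destruct (uf_ex HV _ (uf_and _ HV _ _ (HPhi f Hf (eps / 2) ltac:(lra)) (HL (eps / 2) ltac:(lra)))) as [i [h1 h2]].
    apply Rabs_def2 in h1, h2. apply Rabs_def1; lra. }
  destruct (Hr Phi) as [y Hy].
  - intros f h Hf Hh. apply Huniq.
    + destruct Hf as [[Hf1 Hf2] [K1 HK1]]. destruct Hh as [[Hh1 Hh2] [K2 HK2]].
      split; [split; intros; rewrite ?Hf1, ?Hh1, ?Hf2, ?Hh2; ring|].
      exists (K1 + K2). intros x. specialize (HK1 x). specialize (HK2 x).
      pose proof (Rabs_triang (f x) (h x)). lra.
    + intros eps He.
      apply (uf_and_mono HV _ _ _ (HPhi f Hf (eps / 2) ltac:(lra)) (HPhi h Hh (eps / 2) ltac:(lra))).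
      intros i h1 h2. apply Rabs_def2 in h1, h2. apply Rabs_def1; lra.
  - intros a f Hf. apply Huniq.
    + destruct Hf as [[Hf1 Hf2] [K1 HK1]].
      split; [split; intros; rewrite ?Hf1, ?Hf2; ring|].
      exists (Rabs a * K1). intros x. rewrite Rabs_mult, Rmult_assoc.
      apply Rmult_le_compat_l; auto using Rabs_pos.
    + intros eps He. pose proof (Rabs_pos a).
      assert (Hp : 0 < eps / (Rabs a + 1)) by (apply Rdiv_lt_0_compat; lra).
      apply (uf_mono _ HV _ _ (HPhi f Hf _ Hp)). intros i h1.
      rewrite <- Rmult_minus_distr_l, Rabs_mult.
      apply Rle_lt_trans with (Rabs a * (eps / (Rabs a + 1))).
      * apply Rmult_le_compat_l; lra.
      * apply Rlt_le_trans with ((Rabs a + 1) * (eps / (Rabs a + 1))); [nra|right; field; lra].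
  - exists M. intros f K Hf HK HfK. apply le_epsilon. intros eps He.
    destruct (uf_ex HV _ (uf_and _ HV _ _ HM (HPhi f Hf eps He))) as [i [h1 h2]].
    pose proof (Rabs_triang_inv (Phi f) (f (g i))). rewrite Rabs_minus_sym in h2.
    specialize (HfK (g i)). assert (K * vnorm (g i) <= M * K) by nra. lra.
  - exists y. intros f Hf eps He. rewrite <- Hy by auto. auto.
Qed.

End WeakLimit.

(** * Weakly null sequences with upper p-estimates *)

Definition skip (j i : nat) : nat := if Nat.ltb i j then i else S i.

Lemma vsum_skip {X : Banach} n j (g : nat -> X) : (j <= n)%nat ->
  vsum (S n) g = vadd (vsum n (fun i => g (skip j i))) (g j).
Proof.
  induction n; intros H.
  - replace j with 0%nat by lia. reflexivity.
  - destruct (Nat.eq_dec j (S n)) as [->|Hj].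
    + cbn [vsum]. f_equal. f_equal; [apply vsum_ext; intros i Hi|];
        unfold skip; [destruct (Nat.ltb_spec i (S n))|destruct (Nat.ltb_spec n (S n))]; auto; lia.
    + change (vsum (S (S n)) g) with (vadd (vsum (S n) g) (g (S n))).
      rewrite IHn by lia. cbn [vsum].
      replace (skip j n) with (S n) by (unfold skip; destruct (Nat.ltb_spec n j); lia).
      vlin.
Qed.

Definition lin_indep {X : Banach} (n : nat) (v : nat -> X) : Prop :=
  forall c : nat -> R, vsum n (fun i => vscal (c i) (v i)) = vzero ->
    forall i, (i < n)%nat -> c i = 0.

Definition infinite_in {X : Banach} (G : X -> Prop) : Prop :=
  forall n, exists v : nat -> X, (forall i, (i < n)%nat -> G (v i)) /\ lin_indep n v.

Lemma vsum_lin_comb {X : Banach} n (a b : nat -> R) (x : nat -> X) y :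
  vsum n (fun i => vscal (a i) (vsub (x i) (vscal (b i) y))) =
  vsub (vsum n (fun i => vscal (a i) (x i))) (vscal (rsum n (fun i => a i * b i)) y).
Proof.
  induction n; simpl; [vlin|]. rewrite IHn. vlin.
Qed.

(** Gaussian elimination: among n + 1 independent vectors, one with nonzero coefficient along w
    serves to cancel that coefficient in the n others, which stay independent. *)
Lemma infinite_in_hyperplane {X : Banach} (G H : X -> Prop) (w : X) :
  subspace G -> subspace H ->
  infinite_in (fun x => G x /\ exists e c, H e /\ x = vadd e (vscal c w)) ->
  infinite_in (fun x => G x /\ H x).
Proof.
  intros HG HH Hinf n. destruct (Hinf (S n)) as (v & Hv & Hind).
  destruct (choice (fun i c => (i < S n)%nat -> exists e, H e /\ v i = vadd e (vscal c w))) as [c Hc].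
  { intros i. destruct (classic (i < S n)%nat) as [h|h]; [|exists 0; tauto].
    destruct (Hv i h) as (_ & e & c & He & E). exists c; intros _; exists e; auto. }
  destruct (classic (exists j, (j <= n)%nat /\ c j <> 0)) as [(j & Hj & Hcj)|Hall].
  - assert (Hsk : forall i, (i < n)%nat -> (skip j i < S n)%nat) by
      (intros i Hi; unfold skip; destruct (Nat.ltb_spec i j); lia).
    set (b := fun i => c (skip j i) / c j).
    exists (fun i => vsub (v (skip j i)) (vscal (b i) (v j))). split.
    + intros i Hi. split.
      * apply subspace_sub; auto; [|apply HG]; apply Hv; auto; lia.
      * destruct (Hc (skip j i) (Hsk i Hi)) as (e1 & He1 & E1).
        destruct (Hc j ltac:(lia)) as (e2 & He2 & E2).
        replace (vsub (v (skip j i)) (vscal (b i) (v j))) with (vsub e1 (vscal (b i) e2)).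
        { apply subspace_sub; auto. apply HH; auto. }
        rewrite E1, E2. unfold b. vlin_goals; field; auto.
    + intros a Ha. rewrite vsum_lin_comb in Ha.
      set (s := rsum n (fun i => a i * b i)) in *.
      (* Coefficients of the same combination in terms of the original vectors; - s collects the
         subtracted multiples of v j. *)
      set (a' := fun i => if Nat.ltb i j then a i else if Nat.eqb i j then - s else a (pred i)).
      assert (Hask : forall i, a' (skip j i) = a i).
      { intros i. unfold a', skip. destruct (Nat.ltb_spec i j).
        - destruct (Nat.ltb_spec i j); auto; lia.
        - destruct (Nat.ltb_spec (S i) j); [lia|]. destruct (Nat.eqb_spec (S i) j); [lia|auto]. }
      assert (Haj : a' j = - s).
      { unfold a'. destruct (Nat.ltb_spec j j); [lia|]. rewrite Nat.eqb_refl; auto. }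
      intros i Hi. rewrite <- Hask. apply Hind; auto.
      rewrite (vsum_skip n j) by auto. rewrite Haj, <- Ha.
      rewrite (vsum_ext n (fun i => vscal (a' (skip j i)) (v (skip j i)))
        (fun i => vscal (a i) (v (skip j i)))) by (intros; rewrite Hask; auto).
      vlin.
  - exists v. split.
    + intros i Hi. split; [apply Hv; lia|].
      destruct (Hc i ltac:(lia)) as (e & He & ->).
      replace (c i) with 0 by (apply NNPP; intros h; apply Hall; exists i; split; [lia|auto]).
      rewrite vscal0, vadd0; auto.
    + intros a Ha i Hi.
      set (a' := fun i => if Nat.ltb i n then a i else 0).
      assert (Hai : a' i = 0).
      { apply Hind; [|lia]. cbn [vsum]. unfold a' at 2. rewrite Nat.ltb_irrefl, vscal0, vadd0, <- Ha.
        apply vsum_ext. intros k Hk. unfold a'. destruct (Nat.ltb_spec k n); auto; lia. }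
      unfold a' in Hai. destruct (Nat.ltb_spec i n); auto; lia.
Qed.

(** By induction G has infinite-dimensional intersection with E + span (w n), and passing from there
    to E costs at most one dimension. *)
Lemma infinite_in_finite_codim {X : Banach} (G : X -> Prop) (n : nat) :
  forall (E : X -> Prop) (w : nat -> X), subspace G -> subspace E ->
  (forall z, exists e (c : nat -> R), E e /\ z = vadd e (vsum n (fun i => vscal (c i) (w i)))) ->
  infinite_in G -> infinite_in (fun x => G x /\ E x).
Proof.
  induction n as [|n IH]; intros E w HG HE Hw Hinf.
  - intros m. destruct (Hinf m) as (v & Hv & Hi). exists v. split; auto.
    intros i h. split; auto. destruct (Hw (v i)) as (e & c & He & ->). simpl. now rewrite vadd0.
  - apply (infinite_in_hyperplane G E (w n)); auto.
    pose proof HE as (HE0 & HEa & HEs).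
    apply (IH (fun x => exists e c, E e /\ x = vadd e (vscal c (w n))) w); auto.
    + split; [|split].
      * exists vzero, 0; split; auto. vlin.
      * intros x y (e1 & c1 & H1 & ->) (e2 & c2 & H2 & ->).
        exists (vadd e1 e2), (c1 + c2); split; auto. vlin.
      * intros a x (e1 & c1 & H1 & ->). exists (vscal a e1), (a * c1); split; auto. vlin.
    + intros z. destruct (Hw z) as (e & c & He & Hz). simpl in Hz.
      exists (vadd e (vscal (c n) (w n))), c. split.
      * exists e, (c n); auto.
      * rewrite Hz. vlin.
Qed.

Lemma infinite_in_nonzero {X : Banach} (G : X -> Prop) :
  infinite_in G -> exists x, G x /\ x <> vzero.
Proof.
  intros H. destruct (H 1%nat) as (v & Hv & Hi). exists (v 0%nat). split; [apply Hv; lia|].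
  intros E. assert (1 = 0); [|lra]. apply (Hi (fun _ => 1)) with (i := 0%nat); [|lia].
  simpl. rewrite E. vlin.
Qed.

Section Construction.
Context (X : Banach) (p : R).
Hypothesis Hp : 1 < p.
Hypothesis Hinf : infinite_dim X.

Section Sequence.
Context (B : R).

Hypothesis Hstep : forall z : X,
  exists E s, finite_codim_subspace E /\ 0 < s /\
    forall h, vnorm h <= 1 -> near E s h ->
      rpow (vnorm (vadd z h)) p <= rpow (vnorm z) p + B.

Lemma common_subspace (ys : list X) : exists G, subspace G /\ infinite_in G /\
  forall y h, In y ys -> G h -> vnorm h <= 1 -> rpow (vnorm (vadd y h)) p <= rpow (vnorm y) p + B.
Proof.
  induction ys as [|y ys (G & HG & Gi & H)].
  - exists (fun _ => True). split; [repeat split|split].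
    + intros n. destruct (Hinf n) as [v Hv]. exists v; split; auto.
    + intros y h [].
  - destruct (Hstep y) as (E & s & (H0 & Ha & Hs & n & w & Hw) & Hpos & HE).
    assert (HEs : subspace E) by (repeat split; auto).
    exists (fun x => G x /\ E x). split; [|split].
    + destruct HG as (g0 & ga & gs). repeat split; auto; try apply ga; try apply Ha; try apply gs; try apply Hs; tauto.
    + apply (infinite_in_finite_codim G n E w); auto.
    + intros z h [<-|Hz] [h1 h2] Hh; auto. apply HE; auto. exists h; split; auto.
      replace (vsub h h) with (vzero : X) by vlin. rewrite vnorm0; auto.
Qed.

(** The base points against which a new term is controlled: using all subset sums makes the upper
    estimate valid for every increasing choice of indices. *)
Fixpoint subset_sums (l : list X) : list X :=
  match l with
  | nil => [vzero]
  | x :: l' => subset_sums l' ++ map (fun y => vadd y x) (subset_sums l')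
  end.

Lemma next_term (l : list X) : exists h, vnorm h = 1 /\
  forall y, In y (subset_sums l) -> rpow (vnorm (vadd y h)) p <= rpow (vnorm y) p + B.
Proof.
  destruct (common_subspace (subset_sums l)) as (G & HG & Gi & H).
  destruct (infinite_in_nonzero G Gi) as (x & Hx & Hx0).
  exists (vscal (/ vnorm x) x). pose proof (vnorm_unit x Hx0). split; auto.
  intros y Hy. apply H; auto; [apply HG; auto|lra].
Qed.

Lemma upper_estimate_sequence : exists x : nat -> X, (forall n, vnorm (x n) = 1) /\
  forall k (j : nat -> nat), (forall i, (S i < k)%nat -> (j i < j (S i))%nat) ->
    rpow (vnorm (vsum k (fun i => x (j i)))) p <= B * INR k.
Proof.
  destruct (choice _ next_term) as [next Hnext].
  (* [hist n] lists the terms of index below n, latest first, which matches the recursion of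
     [subset_sums]. *)
  set (hist := fix hist n := match n with O => nil | S n' => next (hist n') :: hist n' end).
  exists (fun n => next (hist n)). split; [intros; apply Hnext|].
  assert (Hmono : forall m n y, (m <= n)%nat -> In y (subset_sums (hist m)) -> In y (subset_sums (hist n))).
  { intros m n y H. induction H; auto. intros Hy. simpl. apply in_or_app; auto. }
  assert (Hzero : forall n, In vzero (subset_sums (hist n))).
  { intros n. apply (Hmono 0%nat); [lia|simpl; auto]. }
  intros k j. induction k as [|k IH]; intros Hj.
  - simpl. rewrite vnorm0, rpow_0. lra.
  - assert (Hsub : forall k', (k' <= S k)%nat -> forall n, (k' = 0%nat \/ (j (pred k') < n)%nat) ->
      In (vsum k' (fun i => next (hist (j i)))) (subset_sums (hist n))).
    { induction k' as [|k' IHk]; intros Hk n Hn; [simpl; auto|].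
      destruct Hn as [Hn|Hn]; [lia|]. simpl in Hn.
      apply (Hmono (S (j k')) n); [lia|]. simpl. apply in_or_app; right.
      apply in_map_iff. eexists; split; [reflexivity|].
      apply IHk; [lia|]. destruct k' as [|k']; [auto|right; simpl; apply Hj; lia]. }
    rewrite S_INR. cbn [vsum].
    destruct (Hnext (hist (j k))) as [_ Hn].
    eapply Rle_trans; [apply Hn, Hsub|].
    + lia.
    + destruct k as [|k]; [auto|right; simpl; apply Hj; lia].
    + specialize (IH ltac:(intros; apply Hj; lia)). lra.
Qed.

End Sequence.

Lemma subsequence_of_infinite (P : nat -> Prop) :
  (forall N, exists n, (N <= n)%nat /\ P n) ->
  exists j : nat -> nat, (forall i, (j i < j (S i))%nat) /\ forall i, P (j i).
Proof.
  intros H. destruct (choice _ H) as [nx Hnx].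
  set (j := fix j i := match i with O => nx 0%nat | S i' => nx (S (j i')) end).
  exists j. split.
  - intros i. simpl. destruct (Hnx (S (j i))); lia.
  - intros [|i]; simpl; apply Hnx.
Qed.

Lemma lin_vsum (f : X -> R) n (g : nat -> X) : is_linear_fun f -> f (vsum n g) = rsum n (fun i => f (g i)).
Proof.
  intros Hf. induction n; simpl; [apply lin_zero; auto|]. destruct Hf as [Ha Hs]. rewrite Ha, IHn; auto.
Qed.

Lemma rsum_lower n (g : nat -> R) eps : (forall i, eps <= g i) -> INR n * eps <= rsum n g.
Proof.
  intros H. induction n; [simpl; lra|]. rewrite S_INR. simpl. specialize (H n). lra.
Qed.

Lemma linear_vs_root (B eps : R) : 0 < eps -> exists n, B * INR n < rpow (INR n * eps) p.
Proof.
  intros He. pose proof (rpow_gt0 eps p He) as Hep.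
  destruct (INR_unbounded (rpow ((Rabs B + 1) / rpow eps p) (1 / (p - 1)) + 1)) as [n Hn].
  exists n. pose proof (rpow_ge0 ((Rabs B + 1) / rpow eps p) (1 / (p - 1))).
  assert (Hn0 : 0 < INR n) by lra.
  rewrite rpow_mult by lra.
  replace (rpow (INR n) p) with (rpow (INR n) (p - 1) * INR n).
  2:{ rewrite <- (rpow_1 (INR n)) at 2 by lra. rewrite rpow_plus. f_equal; ring. }
  assert (Hr : (Rabs B + 1) / rpow eps p <= rpow (INR n) (p - 1)).
  { rewrite <- (rpow_root ((Rabs B + 1) / rpow eps p) (p - 1)) by
      (try apply Rlt_le, Rdiv_lt_0_compat; pose proof (Rabs_pos B); lra).
    apply rpow_le; lra. }
  pose proof (Rle_abs B).
  assert (B < rpow (INR n) (p - 1) * rpow eps p).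
  { apply Rlt_le_trans with ((Rabs B + 1) / rpow eps p * rpow eps p).
    - unfold Rdiv. rewrite Rmult_assoc, Rinv_l by lra. lra.
    - apply Rmult_le_compat_r; lra. }
  nra.
Qed.

(** If g (x n) >= eps along a subsequence, sums of n of its terms have norm at least n eps / K,
    against a growth of order n^(1/p) with p > 1. This is applied to f and to -f. *)
Lemma upper_estimate_weakly_null (x : nat -> X) B :
  (forall k (j : nat -> nat), (forall i, (S i < k)%nat -> (j i < j (S i))%nat) ->
    rpow (vnorm (vsum k (fun i => x (j i)))) p <= B * INR k) -> weakly_null x.
Proof.
  intros Hup f Hf.
  assert (Hkey : forall g, in_dual g -> forall eps, 0 < eps -> exists N, forall n, (N <= n)%nat -> g (x n) < eps).
  { intros g Hg eps He. apply NNPP; intros Hn.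
    destruct (subsequence_of_infinite (fun n => eps <= g (x n))) as (j & Hj & Hjn).
    { intros N. apply NNPP; intros Hn'. apply Hn. exists N. intros n HNn. apply Rnot_le_lt.
      intros h; apply Hn'; exists n; auto. }
    destruct (in_dual_bound g Hg) as (K & HK & HgK).
    destruct (linear_vs_root B (eps / K)) as [n Hn0]; [apply Rdiv_lt_0_compat; auto|].
    specialize (Hup n j ltac:(intros; apply Hj)).
    assert (H : INR n * (eps / K) <= vnorm (vsum n (fun i => x (j i)))).
    { pose proof (rsum_lower n (fun i => g (x (j i))) eps Hjn) as H1.
      rewrite <- lin_vsum in H1 by apply Hg.
      pose proof (HgK (vsum n (fun i => x (j i)))) as H2.
      pose proof (Rle_abs (g (vsum n (fun i => x (j i))))).
      apply (Rmult_le_reg_r K); auto. replace (INR n * (eps / K) * K) with (INR n * eps) by (field; lra). lra. }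
    apply (rpow_le _ _ p ltac:(lra)) in H. lra. }
  intros eps He. destruct (Hkey f Hf eps He) as [N1 H1].
  destruct (Hkey (fun z => -1 * f z)) with (eps := eps) as [N2 H2]; auto.
  { destruct Hf as [[Ha Hs] [K HK]]. split; [split; intros; rewrite ?Ha, ?Hs; ring|].
    exists K. intros z. rewrite Rabs_mult, (Rabs_left (-1)) by lra. specialize (HK z). lra. }
  exists (N1 + N2)%nat. intros n Hn. unfold Rdist. rewrite Rminus_0_r.
  specialize (H1 n ltac:(lia)). specialize (H2 n ltac:(lia)). apply Rabs_def1; lra.
Qed.

(** The upper estimate makes the sequence weakly null, so [co_banach_saks] applies; it passes to the
    subsequence obtained, which therefore has both estimates. *)
Lemma smooth_coBS_sequence : asymp_unif_smooth X p -> co_banach_saks X p ->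
  exists (x : nat -> X) A c, 0 < A /\ 0 < c /\ (forall n, vnorm (x n) = 1) /\ weakly_null x /\
    forall k (j : nat -> nat), (forall i, (S i < k)%nat -> (j i < j (S i))%nat) ->
      vnorm (vsum k (fun i => x (j i))) <= A * rpow (INR k) (1 / p) /\
      ((k <= j 0)%nat -> c * rpow (INR k) (1 / p) <= vnorm (vsum k (fun i => x (j i)))).
Proof.
  intros Hs Hc. destruct (smooth_step X p ltac:(lra) Hs) as (B & HB & Hstep).
  destruct (upper_estimate_sequence B) as (x & Hx & Hup).
  { intros z. destruct (Hstep z 1 ltac:(lra)) as (E & s & H1 & H2 & H3). exists E, s.
    rewrite rpow_base1, Rmult_1_r in H3. auto. }
  pose proof (upper_estimate_weakly_null x B Hup) as Hw.
  destruct (Hc x) as (phi & Hphi & c & Hc0 & Hlow); auto.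
  { exists 1, 1. split; [lra|]. intros n. rewrite Hx. lra. }
  assert (Hphi' : forall m n, (m < n)%nat -> (phi m < phi n)%nat).
  { intros m n H. induction H; [apply Hphi|]. eapply Nat.lt_trans; [apply IHle|apply Hphi]. }
  assert (Hphi_ge : forall n, (n <= phi n)%nat).
  { induction n; [lia|]. specialize (Hphi n). lia. }
  exists (fun n => x (phi n)), (rpow B (1 / p)), c.
  split; [apply rpow_gt0; auto|]. split; [lra|]. split; [auto|]. split.
  - intros f Hf eps He. destruct (Hw f Hf eps He) as [N HN]. exists N. intros n Hn. apply HN.
    specialize (Hphi_ge n). lia.
  - intros k j Hj. split.
    + rewrite <- rpow_mult by (try apply pos_INR; lra). apply rpow_le_root; [lra| |].
      * apply Rmult_le_pos; [lra|apply pos_INR].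
      * apply (Hup k (fun i => phi (j i))). intros; apply Hphi', Hj; auto.
    + intros Hk. apply Rge_le, Hlow; auto.
Qed.

End Construction.

(** * Lipschitz maps on Hamming graphs *)

Lemma weak_limit_const {Z : Banach} {I : Type} (V : (I -> Prop) -> Prop) (y : Z) :
  ultrafilter V -> weak_limit V (fun _ => y) y.
Proof.
  intros HV f Hf eps He. apply (uf_all HV). intros _. unfold Rminus. rewrite Rplus_opp_r, Rabs_R0; auto.
Qed.

(** For U-most n, both f y and f (ys n) are close to f (F (n :: l)) for a common l. *)
Lemma weak_limit_fubini {Z : Banach} U k (F : list nat -> Z) (ys : nat -> Z) y :
  ultrafilter U -> weak_limit (uf_power U (S k)) F y ->
  (forall n, weak_limit (uf_power U k) (fun l => F (n :: l)) (ys n)) -> weak_limit U ys y.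
Proof.
  intros HU Hy Hys f Hf eps He. pose proof (uf_power_ultra U k HU) as HV.
  apply (uf_mono _ HU _ _ (Hy f Hf (eps / 2) ltac:(lra))). intros n Hn.
  destruct (uf_ex HV _ (uf_and _ HV _ _ Hn (Hys n f Hf (eps / 2) ltac:(lra)))) as [l [h1 h2]].
  apply Rabs_def2 in h1, h2. apply Rabs_def1; lra.
Qed.

(** The Lipschitz condition for the Hamming metric, tested on edges. *)
Definition hamming_lipschitz {Z : Banach} (k : nat) (lam : R) (F : list nat -> Z) : Prop :=
  forall l1 n n' l2, length (l1 ++ n :: l2) = k ->
    vnorm (vsub (F (l1 ++ n :: l2)) (F (l1 ++ n' :: l2))) <= lam.

Section Hamming.
Context (Y : Banach) (q B lam : R) (U : (nat -> Prop) -> Prop).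
Hypothesis Hrefl : reflexive Y.
Hypothesis Hlam : 0 < lam.
Hypothesis HU : ultrafilter U.
Hypothesis Hstep : forall (z : Y) lam, 0 < lam ->
    exists E s, finite_codim_subspace E /\ 0 < s /\
      forall h, vnorm h <= lam -> near E s h ->
        rpow (vnorm (vadd z h)) q <= rpow (vnorm z) q + B * rpow lam q.

(* The increments of the successive weak limits of [F] along a branch form a
   weakly null tree, so that smoothness controls the norm one coordinate at a time. *)
Lemma hamming_concentration_aux k : forall (F : list nat -> Y) M y z j,
  hamming_lipschitz k lam F -> (forall l, length l = k -> vnorm (F l) <= M) ->
  weak_limit (uf_power U k) F y ->
  rpow (vnorm z) q <= B * rpow lam q * j ->
  uf_power U k (fun l => rpow (vnorm (vadd z (vsub (F l) y))) q <= B * rpow lam q * (j + INR k)).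
Proof.
  induction k as [|k IH]; intros F M y z j HF HM Hy Hz.
  (* The zeroth power is evaluation at the empty list, whose weak limit is the value itself. *)
  - simpl. assert (E : F [] = y).
    { assert (H : vnorm (vsub (F []) y) <= 0).
      { apply (weak_limit_dist (uf_power_ultra U 0 HU) (fun _ => F []) F); auto.
        - apply weak_limit_const, uf_power_ultra; auto.
        - simpl. replace (vsub (F []) (F [])) with (vzero : Y) by vlin. rewrite vnorm0; lra. }
      pose proof (vnorm_ge0 (vsub (F []) y)).
      assert (H1 : vsub (F []) y = vzero) by (apply vnorm_eq0; lra).
      replace (F []) with (vadd (vsub (F []) y) y) by vlin. rewrite H1. apply vadd0l. }
    rewrite E. replace (vadd z (vsub y y)) with z by vlin. rewrite Rplus_0_r; auto.
  - pose proof (uf_power_ultra U k HU) as HV.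
    assert (Hys : forall n, exists yn, weak_limit (uf_power U k) (fun l => F (n :: l)) yn).
    { intros n. apply (reflexive_weak_limit HV _ M); auto.
      apply (uf_mono _ HV _ _ (uf_power_length U HU k)). intros l Hl; apply HM; simpl; auto. }
    destruct (choice _ Hys) as [ys Hys']. clear Hys.
    pose proof (weak_limit_fubini U k F ys y HU Hy Hys') as Hlim.
    (* Slices at n and n' differ in one entry, so their weak limits are at most [lam] apart; letting
       n' tend to its limit along U compares ys n with y. *)
    assert (Hd : forall n, vnorm (vsub (ys n) y) <= lam).
    { intros n. apply (weak_limit_dist HU (fun _ => ys n) ys); auto using weak_limit_const.
      apply (uf_all HU). intros n'.
      apply (weak_limit_dist HV (fun l => F (n :: l)) (fun l => F (n' :: l))); auto.
      apply (uf_mono _ HV _ _ (uf_power_length U HU k)). intros l Hl.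
      apply (HF [] n n' l). simpl; auto. }
    destruct (Hstep z lam Hlam) as (E & s & HE & Hs & Hh).
    assert (Hnear : U (fun n => near E s (vsub (ys n) y))).
    { apply (weak_limit_near HU ys y (vnorm y + lam)); auto. apply (uf_all HU). intros n.
      pose proof (vnorm_le_add (ys n) y (vsub (ys n) y) ltac:(vlin)). specialize (Hd n). lra. }
    cbn [uf_power]. apply (uf_mono _ HU _ _ Hnear). intros n Hn.
    specialize (Hh _ (Hd n) Hn).
    (* The increment ys n - y is moved into the base point, at the cost of one unit in j. *)
    pose proof (IH (fun l => F (n :: l)) M (ys n) (vadd z (vsub (ys n) y)) (j + 1)) as IHn.
    assert (Hv : uf_power U k (fun l => rpow (vnorm (vadd (vadd z (vsub (ys n) y)) (vsub (F (n :: l)) (ys n)))) q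
      <= B * rpow lam q * (j + 1 + INR k))).
    { apply IHn; auto.
      - intros l1 m m' l2 Hl. apply (HF (n :: l1) m m' l2). simpl; auto.
      - intros l Hl; apply HM; simpl; auto.
      - lra. }
    apply (uf_mono _ HV _ _ Hv). intros l Hl. rewrite S_INR.
    replace (vadd z (vsub (F (n :: l)) y)) with
      (vadd (vadd z (vsub (ys n) y)) (vsub (F (n :: l)) (ys n))) by vlin. lra.
Qed.

End Hamming.

Theorem hamming_concentration (Y : Banach) (q : R) :
  0 < q -> reflexive Y -> asymp_unif_smooth Y q ->
  exists A, 0 < A /\ forall U k lam (F : list nat -> Y) M, ultrafilter U -> 0 < lam ->
    hamming_lipschitz k lam F -> (forall l, length l = k -> vnorm (F l) <= M) ->
    exists y, uf_power U k (fun l => vnorm (vsub (F l) y) <= A * lam * rpow (INR k) (1 / q)).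
Proof.
  intros Hq Hr Hs. destruct (smooth_step Y q Hq Hs) as (B & HB & Hstep).
  exists (rpow B (1 / q)). split; [apply rpow_gt0; auto|].
  intros U k lam F M HU Hlam HF HM. pose proof (uf_power_ultra U k HU) as HV.
  destruct (reflexive_weak_limit HV F M Hr) as [y Hy].
  { apply (uf_mono _ HV _ _ (uf_power_length U HU k)). auto. }
  exists y.
  apply (uf_mono _ HV _ _ (hamming_concentration_aux Y q B lam U Hr Hlam HU Hstep k F M y vzero 0 HF HM Hy
    ltac:(rewrite vnorm0, rpow_0; lra))).
  intros l Hl. rewrite vadd0l, Rplus_0_l in Hl.
  assert (E : rpow B (1 / q) * lam * rpow (INR k) (1 / q) = rpow (B * rpow lam q * INR k) (1 / q)).
  { pose proof (rpow_ge0 lam q). rewrite !rpow_mult by (try apply pos_INR; nra).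
    rewrite rpow_rpow. replace (q * (1 / q)) with 1 by (field; lra). rewrite rpow_1 by lra. auto. }
  rewrite E. apply rpow_le_root; auto.
  apply Rmult_le_pos; [|apply pos_INR]. pose proof (rpow_ge0 lam q); nra.
Qed.

(** * Approximate midpoints *)

Definition approx_mid {Z : Banach} (x y : Z) (delta : R) (u : Z) : Prop :=
  vnorm (vsub u x) <= (1 + delta) / 2 * vnorm (vsub x y) /\
  vnorm (vsub u y) <= (1 + delta) / 2 * vnorm (vsub x y).

Section Basis.
Context {Y : Banach} (e : nat -> Y).

Definition truncate (N : nat) (a : nat -> R) (i : nat) : R := if Nat.ltb i N then a i else 0.

Definition basis_proj (N : nat) (a : nat -> R) : Y := vsum N (fun i => vscal (a i) (e i)).

Lemma expansion_lin_comb a b c y z : expansion e a y -> expansion e b z ->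
  expansion e (fun i => a i + c * b i) (vadd y (vscal c z)).
Proof.
  intros Ha Hb eps He. pose proof (Rabs_pos c).
  destruct (Ha (eps / 2) ltac:(lra)) as [N1 H1].
  destruct (Hb (eps / (2 * (Rabs c + 1)))) as [N2 H2]; [apply Rdiv_lt_0_compat; lra|].
  exists (N1 + N2)%nat. intros n Hn. specialize (H1 n ltac:(lia)). specialize (H2 n ltac:(lia)).
  replace (vsum n (fun i => vscal (a i + c * b i) (e i))) with (vadd (basis_proj n a) (vscal c (basis_proj n b))).
  2:{ unfold basis_proj. rewrite <- vsum_scal, <- vsum_add. apply vsum_ext; intros; vlin. }
  pose proof (vnorm_le_add (vsub (vadd (basis_proj n a) (vscal c (basis_proj n b))) (vadd y (vscal c z)))
    (vsub (basis_proj n a) y) (vscal c (vsub (basis_proj n b) z)) ltac:(vlin)) as H3.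
  rewrite vnormZ in H3. fold (basis_proj n a) in H1. fold (basis_proj n b) in H2.
  assert (Rabs c * vnorm (vsub (basis_proj n b) z) <= (Rabs c + 1) * (eps / (2 * (Rabs c + 1)))).
  { apply Rmult_le_compat; auto using vnorm_ge0; lra. }
  replace ((Rabs c + 1) * (eps / (2 * (Rabs c + 1)))) with (eps / 2) in H0 by (field; lra). lra.
Qed.

Lemma expansion_truncate N a : expansion e (truncate N a) (basis_proj N a).
Proof.
  intros eps He. exists N. intros n Hn.
  replace (vsum n (fun i => vscal (truncate N a i) (e i))) with (basis_proj N a).
  - replace (vsub (basis_proj N a) (basis_proj N a)) with (vzero : Y) by vlin. rewrite vnorm0; auto.
  - induction Hn; unfold basis_proj.
    + apply vsum_ext. intros i Hi. unfold truncate. destruct (Nat.ltb_spec i N); auto; lia.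
    + cbn [vsum]. rewrite <- IHHn. unfold truncate. destruct (Nat.ltb_spec m N); [lia|].
      unfold basis_proj. vlin.
Qed.

Section LowerEstimate.
Context (q : R).
Hypothesis Hq : 1 <= q.
Hypothesis Hlow : lower_lq_estimate e q.
Hypothesis Hbasis : schauder_basis e.

(** Head and tail of an expansion are disjointly supported: this is the lower estimate for two
    blocks. *)
Lemma lower_estimate_split N a y : expansion e a y ->
  rpow (vnorm (basis_proj N a)) q + rpow (vnorm (vsub y (basis_proj N a))) q <= rpow (vnorm y) q.
Proof.
  intros Ha.
  pose proof (Hlow 2%nat (fun n => match n with O => basis_proj N a | _ => vsub y (basis_proj N a) end)
    (fun n => match n with O => truncate N a | _ => fun i => a i + -1 * truncate N a i end)) as H.
  simpl in H. rewrite vadd0l, Rplus_0_l in H.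
  replace (vadd (basis_proj N a) (vsub y (basis_proj N a))) with y in H by vlin.
  apply Rge_le, H.
  - intros [|n] Hn; [apply expansion_truncate|].
    replace (vsub y (basis_proj N a)) with (vadd y (vscal (-1) (basis_proj N a))) by vlin.
    apply expansion_lin_comb; auto. apply expansion_truncate.
  - assert (Hd : forall i, truncate N a i = 0 \/ a i + -1 * truncate N a i = 0).
    { intros i. unfold truncate. destruct (Nat.ltb i N); [right; ring|auto]. }
    intros [|[|n]] [|[|m]] i Hn Hm Hnm; try lia; destruct (Hd i); auto.
Qed.

Lemma proj_norm_le N a y : expansion e a y -> vnorm (basis_proj N a) <= vnorm y.
Proof.
  intros Ha. apply (rpow_le_inv _ _ q); [lra|apply vnorm_ge0|].
  pose proof (lower_estimate_split N a y Ha). pose proof (rpow_ge0 (vnorm (vsub y (basis_proj N a))) q). lra.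
Qed.

Lemma proj_totally_bounded {I : Type} {V : (I -> Prop) -> Prop} (HV : ultrafilter V)
  (b : I -> nat -> R) M N s :
  (forall j, V (fun i => vnorm (vscal (b i j) (e j)) <= M)) -> 0 < s ->
  exists z, V (fun i => vnorm (vsub (basis_proj N (b i)) z) < s).
Proof.
  intros Hb. revert s. induction N as [|N IH]; intros s Hs.
  - exists vzero. apply (uf_all HV). intros i. unfold basis_proj; simpl.
    replace (vsub vzero vzero) with (vzero : Y) by vlin. rewrite vnorm0; auto.
  - destruct (IH (s / 2) ltac:(lra)) as [z Hz].
    assert (Ht : exists t, V (fun i => vnorm (vsub (vscal (b i N) (e N)) t) < s / 2)).
    { destruct (classic (e N = vzero)) as [E|E].
      - exists vzero. apply (uf_all HV). intros i. rewrite E.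
        replace (vsub (vscal (b i N) vzero) vzero) with (vzero : Y) by vlin. rewrite vnorm0; lra.
      - pose proof (vnorm_pos _ E) as He.
        destruct (ulim_exists HV (fun i => b i N) (M / vnorm (e N))) as [L [_ HL]].
        { apply (uf_mono _ HV _ _ (Hb N)). intros i Hi. rewrite vnormZ in Hi.
          apply (Rmult_le_reg_r (vnorm (e N))); auto. field_simplify; lra. }
        exists (vscal L (e N)).
        apply (uf_mono _ HV _ _ (HL (s / 2 / vnorm (e N)) ltac:(apply Rdiv_lt_0_compat; lra))).
        intros i Hi. replace (vsub (vscal (b i N) (e N)) (vscal L (e N))) with (vscal (b i N - L) (e N)) by vlin.
        rewrite vnormZ. apply (Rmult_lt_compat_r (vnorm (e N))) in Hi; auto.
        replace (s / 2 / vnorm (e N) * vnorm (e N)) with (s / 2) in Hi by (field; lra). auto. }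
    destruct Ht as [t Ht]. exists (vadd z t). apply (uf_and_mono HV _ _ _ Hz Ht). intros i h1 h2.
    unfold basis_proj in *. cbn [vsum].
    pose proof (vnorm_le_add (vsub (vadd (vsum N (fun i0 => vscal (b i i0) (e i0))) (vscal (b i N) (e N))) (vadd z t))
      (vsub (vsum N (fun i0 => vscal (b i i0) (e i0))) z) (vsub (vscal (b i N) (e N)) t) ltac:(vlin)). lra.
Qed.

(* If [P_N w] is almost [w], one of [P_N (w - v)], [P_N (w + v)] has norm almost
   [|w|], and the lower estimate leaves little room for the corresponding tail. *)
Lemma midpoint_tail : exists C, 0 < C /\ forall delta (w v : Y) a b N,
  0 < delta <= 1 / 2 -> expansion e a w -> expansion e b v ->
  vnorm (vsub w (basis_proj N a)) <= delta * vnorm w ->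
  vnorm (vsub w v) <= (1 + delta) * vnorm w -> vnorm (vadd w v) <= (1 + delta) * vnorm w ->
  vnorm (vsub v (basis_proj N b)) <= C * rpow delta (1 / q) * vnorm w.
Proof.
  destruct (rpow_1plus_le 1 q ltac:(lra) ltac:(lra)) as (K & HK & HK1).
  (* (K + 2q) delta bounds (1 + delta)^q - (1 - delta)^q, the room that the lower estimate leaves
     for a tail of w + v or w - v. The extra 1 in the constant below pays for the tail of w, at most
     delta ||w||. *)
  set (C0 := rpow (K + 2 * q) (1 / q)). assert (HC0 : 0 < C0) by (apply rpow_gt0; lra).
  exists (C0 + 1). split; [lra|]. intros delta w v a b N Hd Ha Hb HN Hwv Hwv'.
  pose proof (vnorm_ge0 w) as Hw0.
  set (D := vnorm w) in *.
  assert (Hpw : (1 - delta) * D <= vnorm (basis_proj N a)).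
  { pose proof (vnorm_le_add w (vsub w (basis_proj N a)) (basis_proj N a) ltac:(vlin)). fold D in H. lra. }
  assert (Htail : forall c, c = 1 \/ c = -1 -> vnorm (vadd w (vscal c v)) <= (1 + delta) * D ->
    vnorm (basis_proj N a) <= vnorm (vadd (basis_proj N a) (vscal c (basis_proj N b))) ->
    vnorm (vsub v (basis_proj N b)) <= (C0 + 1) * rpow delta (1 / q) * D).
  { intros c Hc H1 H2.
    pose proof (lower_estimate_split N _ _ (expansion_lin_comb a b c w v Ha Hb)) as Hs.
    replace (basis_proj N (fun i => a i + c * b i)) with (vadd (basis_proj N a) (vscal c (basis_proj N b))) in Hs.
    2:{ unfold basis_proj. rewrite <- vsum_scal, <- vsum_add. apply vsum_ext; intros; vlin. }
    set (R0 := vsub (vadd w (vscal c v)) (vadd (basis_proj N a) (vscal c (basis_proj N b)))) in *.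
    assert (HR : vnorm R0 <= C0 * rpow delta (1 / q) * D).
    { replace (C0 * rpow delta (1 / q) * D) with (rpow ((K + 2 * q) * delta * rpow D q) (1 / q)).
      2:{ pose proof (rpow_ge0 D q). rewrite !rpow_mult by nra. rewrite rpow_rpow.
          replace (q * (1 / q)) with 1 by (field; lra). rewrite rpow_1 by auto. reflexivity. }
      apply rpow_le_root; [lra| |].
      - pose proof (rpow_ge0 D q). apply Rmult_le_pos; nra.
      - apply (rpow_le _ _ q ltac:(lra)) in H1. rewrite rpow_mult in H1 by lra.
        assert (H3 : (1 - delta) * D <= vnorm (vadd (basis_proj N a) (vscal c (basis_proj N b)))) by lra.
        apply (rpow_le _ _ q ltac:(lra)) in H3. rewrite rpow_mult in H3 by lra.
        pose proof (HK1 delta ltac:(lra)) as H4. rewrite Rmult_1_l in H4.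
        pose proof (rpow_1minus_ge q delta ltac:(lra) ltac:(lra)) as H5.
        pose proof (rpow_ge0 D q). nra. }
    pose proof (rpow_small_ge delta q Hq ltac:(lra)) as Hsm.
    assert (E : vnorm (vsub v (basis_proj N b)) = vnorm (vscal c (vsub v (basis_proj N b)))).
    { rewrite vnormZ. replace (Rabs c) with 1; [ring|].
      destruct Hc as [->| ->]; [rewrite Rabs_R1|rewrite Rabs_left]; lra. }
    rewrite E.
    pose proof (vnorm_le_add (vscal c (vsub v (basis_proj N b))) R0 (vopp (vsub w (basis_proj N a))) ltac:(unfold R0; vlin)).
    rewrite vnorm_opp in H. assert (delta * D <= rpow delta (1 / q) * D) by (apply Rmult_le_compat_r; auto).
    lra. }
  destruct (Rle_dec (vnorm (basis_proj N a)) (vnorm (vadd (basis_proj N a) (vscal 1 (basis_proj N b))))) as [h|h].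
  - apply (Htail 1); auto. replace (vadd w (vscal 1 v)) with (vadd w v) by vlin. auto.
  - apply (Htail (-1)); auto.
    + replace (vadd w (vscal (-1) v)) with (vsub w v) by vlin. auto.
    + pose proof (vnorm_le_add (vscal 2 (basis_proj N a)) (vadd (basis_proj N a) (vscal 1 (basis_proj N b)))
        (vadd (basis_proj N a) (vscal (-1) (basis_proj N b))) ltac:(vlin)) as H.
      rewrite vnormZ, Rabs_pos_eq in H by lra. lra.
Qed.

(** With the midpoint m as origin, x and y become w and -w, and [midpoint_tail] applies to g i - m
    for one fixed N: the heads converge along V in a finite-dimensional span, and the tails are
    small. *)
Lemma approx_mid_concentration : exists C, 0 < C /\
  forall (I : Type) (V : (I -> Prop) -> Prop) (g : I -> Y) (x y : Y) delta,
    ultrafilter V -> 0 < delta <= 1 / 2 -> V (fun i => approx_mid x y delta (g i)) ->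
    exists z, V (fun i => vnorm (vsub (g i) z) <= C * rpow delta (1 / q) * vnorm (vsub x y)).
Proof.
  destruct midpoint_tail as (C & HC & Htail). exists (C + 1). split; [lra|].
  intros I V g x y delta HV Hd Hg.
  set (m := vscal (1 / 2) (vadd x y)). set (w := vscal (1 / 2) (vsub x y)).
  assert (Hw : vnorm w = 1 / 2 * vnorm (vsub x y)) by (apply vnorm_scal_eq; [reflexivity|lra]).
  pose proof (rpow_gt0 delta (1 / q) ltac:(lra)) as Hr.
  (* When x = y, the points equal x for V-almost all i; otherwise ||w|| > 0, so N can be chosen with
     the tail of w below delta ||w||. *)
  destruct (Req_dec (vnorm (vsub x y)) 0) as [E0|E0].
  - exists x. apply (uf_mono _ HV _ _ Hg). intros i [h _]. rewrite E0 in *. lra.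
  - pose proof (vnorm_ge0 (vsub x y)) as Hp.
    destruct (choice (fun (i : I) a => expansion e a (vsub (g i) m))) as [b Hb].
    { intros i. destruct (Hbasis (vsub (g i) m)) as (a & Ha & _). exists a; auto. }
    destruct (Hbasis w) as (a & Ha & _).
    destruct (Ha (delta * vnorm w)) as [N HN]; [apply Rmult_lt_0_compat; lra|].
    specialize (HN N ltac:(lia)). rewrite vsub_sym in HN.
    assert (Hwg : forall i, approx_mid x y delta (g i) ->
      vnorm (vsub w (vsub (g i) m)) <= (1 + delta) * vnorm w /\
      vnorm (vadd w (vsub (g i) m)) <= (1 + delta) * vnorm w).
    { intros i [h1 h2]. rewrite Hw. split.
      - rewrite (vnorm_opp_eq (vsub w (vsub (g i) m)) (vsub (g i) x)); [lra|].
        unfold w, m. vlin.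
      - replace (vadd w (vsub (g i) m)) with (vsub (g i) y); [lra|].
        unfold w, m. vlin. }
    (* Here ||g i - m|| <= (2 + delta) ||w||, and each coordinate term is a difference of two
       projections, so 5 ||w|| is a bound, and 6 ||w|| with it. *)
    destruct (proj_totally_bounded HV b (6 * vnorm w) N (rpow delta (1 / q) * vnorm w)) as [z Hz].
    { intros j. apply (uf_mono _ HV _ _ Hg). intros i Hi.
      destruct (Hwg i Hi) as [h1 h2].
      pose proof (vnorm_le_add (vsub (g i) m) (vadd w (vsub (g i) m)) (vopp w) ltac:(vlin)) as H3.
      rewrite vnorm_opp in H3.
      pose proof (proj_norm_le (S j) _ _ (Hb i)) as H4. pose proof (proj_norm_le j _ _ (Hb i)) as H5.
      unfold basis_proj in H4, H5. cbn [vsum] in H4.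
      set (P := vsum j (fun k => vscal (b i k) (e k))) in *.
      pose proof (vnorm_le_add (vscal (b i j) (e j)) (vadd P (vscal (b i j) (e j))) (vopp P) ltac:(vlin)) as H6.
      rewrite vnorm_opp in H6. pose proof (vnorm_ge0 w). nra. }
    { apply Rmult_lt_0_compat; lra. }
    exists (vadd m z). apply (uf_and_mono HV _ _ _ Hz Hg). intros i h1 h2.
    destruct (Hwg i h2) as [h3 h4].
    pose proof (Htail delta w (vsub (g i) m) a (b i) N Hd Ha (Hb i) ltac:(unfold basis_proj; lra) h3 h4) as H.
    pose proof (vnorm_le_add (vsub (g i) (vadd m z)) (vsub (vsub (g i) m) (basis_proj N (b i)))
      (vsub (basis_proj N (b i)) z) ltac:(vlin)) as H'.
    rewrite Hw in *.
    assert (0 <= C * rpow delta (1 / q) * vnorm (vsub x y)) by (repeat apply Rmult_le_pos; lra).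
    assert (0 <= rpow delta (1 / q) * vnorm (vsub x y)) by (repeat apply Rmult_le_pos; lra).
    lra.
Qed.

End LowerEstimate.
End Basis.

(* Points that nearly realise the Lipschitz constant of [g] at infinity have
   their approximate midpoints mapped to approximate midpoints. *)
Lemma coarse_lipschitz_midpoints {X Y : Banach} (g : X -> Y) L delta T :
  (exists v : X, v <> vzero) -> 0 < L ->
  (forall x y, vnorm (vsub (g x) (g y)) <= L * vnorm (vsub x y) + L) ->
  0 < delta <= 1 / 4 ->
  exists x y, T <= vnorm (vsub x y) /\
    ((forall u, approx_mid x y delta u -> approx_mid (g x) (g y) (2 * delta) (g u)) \/
     (forall u, approx_mid x y delta u -> vnorm (vsub (g u) (g x)) <= delta * vnorm (vsub x y))).
Proof.
  intros [v0 Hv0] HL Hg Hd.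
  (* [S] collects the Lipschitz constants valid at large distances; its infimum is the constant at
     infinity. *)
  set (S := fun s => exists t, forall x y, t <= vnorm (vsub x y) ->
    vnorm (vsub (g x) (g y)) <= s * vnorm (vsub x y)).
  (* As delta <= 1/4, midpoints stay at distance at least ||x - y||/4 from both ends, so ||x - y||
     >= 4t makes a constant of [S] with threshold t available there. *)
  assert (Hfar : forall x y u : X, approx_mid x y delta u ->
    1 / 4 * vnorm (vsub x y) <= vnorm (vsub u x) /\ 1 / 4 * vnorm (vsub x y) <= vnorm (vsub u y)).
  { intros x y u [h1 h2].
    pose proof (vnorm_le_add (vsub x y) (vopp (vsub u x)) (vsub u y) ltac:(vlin)) as H.
    rewrite vnorm_opp in H. pose proof (vnorm_ge0 (vsub x y)). nra. }
  (* A constant at most delta yields the second alternative for any two sufficiently distant points.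
     Otherwise the infimum is at least delta, hence positive, and can be nearly attained up to a
     factor. *)
  destruct (classic (exists s, S s /\ s <= delta)) as [(s & (t & Ht) & Hs)|Hn].
  - pose proof (vnorm_unit v0 Hv0) as Hu. set (v := vscal (/ vnorm v0) v0) in *.
    set (D := Rmax 0 (Rmax T (4 * t))).
    pose proof (Rmax_l 0 (Rmax T (4 * t))). pose proof (Rmax_r 0 (Rmax T (4 * t))).
    pose proof (Rmax_l T (4 * t)). pose proof (Rmax_r T (4 * t)). fold D in H, H0.
    assert (HD : vnorm (vsub (vscal D v) vzero) = D).
    { rewrite (vnorm_scal_eq D _ v); [rewrite Hu; ring|vlin|auto]. }
    exists (vscal D v), vzero. rewrite HD. split; [lra|]. right. intros u Hm.
    destruct (Hfar _ _ _ Hm) as [h1 _]. destruct Hm as [h2 _]. rewrite HD in *.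
    specialize (Ht u (vscal D v) ltac:(lra)).
    pose proof (vnorm_ge0 (vsub u (vscal D v))) as H5.
    apply Rle_trans with (delta * vnorm (vsub u (vscal D v))).
    + eapply Rle_trans; [apply Ht|]. apply Rmult_le_compat_r; auto.
    + apply Rmult_le_compat_l; nra.
  - destruct (completeness (fun r => S (- r))) as [i0 [H1 H2]].
    + exists 0. intros r Hr. apply Rnot_lt_le; intros Hlt. apply Hn. exists (- r). split; auto. lra.
    + exists (- (2 * L)). rewrite Ropp_involutive. exists 1. intros x y Hxy. specialize (Hg x y). nra.
    + set (s0 := - i0).
      assert (Hs0 : delta <= s0).
      { unfold s0. assert (i0 <= - delta); [|lra]. apply H2. intros r Hr.
        apply Rnot_lt_le; intros Hlt. apply Hn. exists (- r). split; auto. lra. }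
      assert (Hlow : forall s, S s -> s0 <= s).
      { intros s Hs. unfold s0. assert (- s <= i0); [|lra]. apply H1. rewrite Ropp_involutive; auto. }
      (* The margin delta/8 satisfies (1 + delta/8)(1 + delta) <= (1 + 2 delta)(1 - delta/8), which
         turns delta-midpoints into 2 delta-midpoints. *)
      assert (Hup : exists s, S s /\ s < s0 * (1 + delta / 8)).
      { apply NNPP; intros Hn'. assert (i0 <= - (s0 * (1 + delta / 8))); [|unfold s0 in *; nra].
        apply H2. intros r Hr. apply Rnot_lt_le; intros Hlt. apply Hn'. exists (- r). split; auto. lra. }
      destruct Hup as (s & (t & Ht) & Hs).
      assert (Hs2 : exists x y, Rmax T (4 * t) <= vnorm (vsub x y) /\
        s0 * (1 - delta / 8) * vnorm (vsub x y) <= vnorm (vsub (g x) (g y))).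
      { apply NNPP; intros Hn'. assert (s0 <= s0 * (1 - delta / 8)); [|nra].
        apply Hlow. exists (Rmax T (4 * t)). intros x y Hxy. apply Rnot_lt_le; intros Hlt.
        apply Hn'. exists x, y. split; auto. lra. }
      destruct Hs2 as (x & y & Hxy & Hgxy).
      pose proof (Rmax_l T (4 * t)). pose proof (Rmax_r T (4 * t)).
      exists x, y. split; [lra|]. left. intros u Hm.
      destruct (Hfar _ _ _ Hm) as [h1 h2]. destruct Hm as [h3 h4].
      pose proof (Ht u x ltac:(lra)) as G1. pose proof (Ht u y ltac:(lra)) as G2.
      set (D := vnorm (vsub x y)) in *. assert (HD : 0 <= D) by apply vnorm_ge0.
      assert (Hss : 0 < s) by (specialize (Hlow s ltac:(exists t; auto)); lra).
      assert (Hkey : s * ((1 + delta) / 2 * D) <= (1 + 2 * delta) / 2 * vnorm (vsub (g x) (g y))).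
      { apply Rle_trans with ((1 + 2 * delta) / 2 * (s0 * (1 - delta / 8) * D)).
        2:{ apply Rmult_le_compat_l; lra. }
        apply Rle_trans with (s0 * (1 + delta / 8) * ((1 + delta) / 2 * D)).
        { apply Rmult_le_compat_r; nra. }
        assert (0 <= s0 * D) by nra.
        assert ((1 + delta / 8) * (1 + delta) <= (1 + 2 * delta) * (1 - delta / 8)) by nra.
        nra. }
      split; (eapply Rle_trans; [|apply Hkey]).
      * eapply Rle_trans; [apply G1|]. apply Rmult_le_compat_l; lra.
      * eapply Rle_trans; [apply G2|]. apply Rmult_le_compat_l; lra.
Qed.

Lemma coarse_midpoint_concentration {X Y : Banach} (e : nat -> Y) q (g : X -> Y) L :
  1 <= q -> schauder_basis e -> lower_lq_estimate e q ->
  (exists v : X, v <> vzero) -> 0 < L ->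
  (forall x y, vnorm (vsub (g x) (g y)) <= L * vnorm (vsub x y) + L) ->
  exists C, 0 < C /\ forall delta T, 0 < delta <= 1 / 4 ->
    exists x y, T <= vnorm (vsub x y) /\
      forall (I : Type) (V : (I -> Prop) -> Prop) (h : I -> X),
        ultrafilter V -> V (fun i => approx_mid x y delta (h i)) ->
        exists z, V (fun i => vnorm (vsub (g (h i)) z) <= C * rpow delta (1 / q) * vnorm (vsub x y)).
Proof.
  intros Hq Hb Hlow Hv HL Hg.
  destruct (approx_mid_concentration e q Hq Hlow Hb) as (C & HC & Hmid).
  pose proof (rpow_gt0 2 (1 / q) ltac:(lra)) as H2.
  assert (HC2 : 0 < C * rpow 2 (1 / q) * (2 * L)) by (repeat apply Rmult_lt_0_compat; lra).
  (* The factor 2^(1/q) comes from 2 delta-midpoints, and 2L from ||g x - g y|| <= 2L ||x - y||,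
     valid once ||x - y|| >= 1; the summand 1 covers the second alternative. *)
  exists (C * rpow 2 (1 / q) * (2 * L) + 1). split; [lra|]. intros delta T Hd.
  pose proof (rpow_gt0 delta (1 / q) ltac:(lra)) as Hr.
  destruct (coarse_lipschitz_midpoints g L delta (Rmax T 1) Hv HL Hg Hd) as (x & y & HT & Hcase).
  pose proof (Rmax_l T 1). pose proof (Rmax_r T 1).
  exists x, y. split; [lra|]. intros I V h HV Hh. set (D := vnorm (vsub x y)) in *.
  assert (H0D : 0 <= C * rpow 2 (1 / q) * (2 * L) * rpow delta (1 / q) * D)
    by (repeat apply Rmult_le_pos; lra).
  assert (H1D : 0 <= rpow delta (1 / q) * D) by (repeat apply Rmult_le_pos; lra).
  destruct Hcase as [Hc|Hc].
  - destruct (Hmid I V (fun i => g (h i)) (g x) (g y) (2 * delta) HV ltac:(lra)) as [z Hz].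
    { apply (uf_mono _ HV _ _ Hh). intros i Hi; auto. }
    exists z. apply (uf_mono _ HV _ _ Hz). intros i Hi. eapply Rle_trans; [apply Hi|].
    rewrite rpow_mult by lra. specialize (Hg x y). fold D in Hg.
    assert (vnorm (vsub (g x) (g y)) <= 2 * L * D) by nra.
    apply Rle_trans with (C * (rpow 2 (1 / q) * rpow delta (1 / q)) * (2 * L * D)); [|lra].
    apply Rmult_le_compat_l; auto. repeat apply Rmult_le_pos; lra.
  - exists (g x). apply (uf_mono _ HV _ _ Hh). intros i Hi. eapply Rle_trans; [apply Hc; auto|].
    pose proof (rpow_small_ge delta q Hq ltac:(lra)). fold D. nra.
Qed.

(** * Sums along lists of indices *)

Section ListSum.
Context {X : Banach} (x : nat -> X).

Fixpoint lsum (l : list nat) : X :=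
  match l with nil => vzero | n :: l' => vadd (x n) (lsum l') end.

Lemma lsum_vsum l : lsum l = vsum (length l) (fun i => x (nth i l 0%nat)).
Proof.
  induction l as [|n l IH]; [reflexivity|].
  cbn [length lsum]. rewrite (vsum_skip (length l) 0) by lia. rewrite IH, vaddC. reflexivity.
Qed.

Lemma lsum_update l1 n n' l2 :
  vsub (lsum (l1 ++ n :: l2)) (lsum (l1 ++ n' :: l2)) = vsub (x n) (x n').
Proof.
  induction l1 as [|m l1 IH]; simpl; [vlin|]. rewrite <- IH. vlin.
Qed.

Lemma lsum_norm_le l : (forall n, vnorm (x n) = 1) -> vnorm (lsum l) <= INR (length l).
Proof.
  intros Hx. induction l as [|n l IH]; [simpl; rewrite vnorm0; lra|].
  cbn [lsum length]. rewrite S_INR. pose proof (vnorm_tri _ (x n) (lsum l)). rewrite Hx in H. lra.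
Qed.

(** For most lists every entry n satisfies |f (x n)| < eps / (k + 1), so the k terms add up to less
    than eps. *)
Lemma lsum_weak_limit U k :
  ultrafilter U -> (forall m, U (fun n => (m <= n)%nat)) -> weakly_null x ->
  weak_limit (uf_power U k) lsum vzero.
Proof.
  intros HU Hfree Hw f Hf eps He. pose proof (uf_power_ultra U k HU) as HV.
  pose proof (pos_INR k) as Hk.
  assert (Hp : 0 < eps / (INR k + 1)) by (apply Rdiv_lt_0_compat; lra).
  assert (Hx : U (fun n => Rabs (f (x n)) < eps / (INR k + 1))).
  { destruct (Hw f Hf _ Hp) as [N HN]. apply (uf_mono _ HU _ _ (Hfree N)). intros n Hn.
    specialize (HN n Hn). unfold Rdist in HN. rewrite Rminus_0_r in HN. auto. }
  apply (uf_and_mono HV _ _ _ (uf_power_forall U HU _ k Hx) (uf_power_length U HU k)).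
  intros l Hall Hl. destruct Hf as [Hlin _]. rewrite (lin_zero f Hlin), Rminus_0_r.
  assert (H : Rabs (f (lsum l)) <= INR (length l) * (eps / (INR k + 1))).
  { clear Hl. induction Hall as [|n l Hn Hall IH].
    - simpl. rewrite (lin_zero f Hlin), Rabs_R0. lra.
    - cbn [lsum length]. rewrite S_INR. destruct Hlin as [Ha _]. rewrite Ha.
      pose proof (Rabs_triang (f (x n)) (f (lsum l))). lra. }
  rewrite Hl in H. apply Rle_lt_trans with (1 := H).
  apply Rlt_le_trans with ((INR k + 1) * (eps / (INR k + 1))); [nra|right; field; lra].
Qed.

End ListSum.

Lemma weak_limit_scal {Z : Banach} {I : Type} (V : (I -> Prop) -> Prop) (g : I -> Z) t :
  ultrafilter V -> weak_limit V g vzero -> weak_limit V (fun i => vscal t (g i)) vzero.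
Proof.
  intros HV Hg f Hf eps He. pose proof (Rabs_pos t).
  apply (uf_mono _ HV _ _ (Hg f Hf (eps / (Rabs t + 1)) ltac:(apply Rdiv_lt_0_compat; lra))).
  intros i Hi. destruct Hf as [Hlin _]. rewrite (lin_zero f Hlin), Rminus_0_r in *.
  destruct Hlin as [_ Hs]. rewrite Hs, Rabs_mult.
  apply Rle_lt_trans with (Rabs t * (eps / (Rabs t + 1))); [apply Rmult_le_compat_l; lra|].
  assert (0 < eps / (Rabs t + 1)) by (apply Rdiv_lt_0_compat; lra).
  apply Rlt_le_trans with ((Rabs t + 1) * (eps / (Rabs t + 1))); [nra|right; field; lra].
Qed.

(** * Choice of the number of summands k and of the radius eta *)

Lemma rpow_exponent_gap a b eps : a < b -> 0 < eps ->
  exists k, (1 <= k)%nat /\ rpow (INR k) a <= eps * rpow (INR k) b.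
Proof.
  intros Hab He. set (K := rpow (/ eps) (1 / (b - a))).
  pose proof (Rinv_0_lt_compat _ He) as Hi.
  destruct (INR_unbounded (K + 1)) as [k Hk].
  assert (HK : 0 < K) by (apply rpow_gt0; auto).
  exists k. split; [apply INR_le; simpl; lra|].
  replace b with (a + (b - a)) by ring. rewrite <- rpow_plus.
  assert (H : / eps <= rpow (INR k) (b - a)).
  { rewrite <- (rpow_root (/ eps) (b - a)) by lra. apply rpow_le; fold K; lra. }
  assert (1 <= eps * rpow (INR k) (b - a)).
  { replace 1 with (eps * / eps) by (field; lra). apply Rmult_le_compat_l; lra. }
  pose proof (rpow_ge0 (INR k) a). nra.
Qed.

(** As p/q > 1, eta^(p/q) is small against eta. With delta = B eta^p, midpoints in X thus spread at
    a scale eta that beats the concentration scale delta^(1/q) of their images. *)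
Lemma rpow_small_radius B p q eps : 0 < B -> 0 < q -> q < p -> 0 < eps ->
  exists eta, 0 < eta /\ B * rpow eta p <= 1 / 4 /\ rpow (B * rpow eta p) (1 / q) <= eps * eta.
Proof.
  intros HB Hq Hqp He. set (b := rpow B (1 / q)). assert (Hb : 0 < b) by (apply rpow_gt0; auto).
  set (r := p / q - 1).
  assert (Hr : 0 < r).
  { unfold r. apply Rlt_0_minus. apply (Rmult_lt_reg_r q); auto. field_simplify; lra. }
  assert (H4B : 0 < 1 / (4 * B)) by (apply Rdiv_lt_0_compat; lra).
  assert (Heb : 0 < eps / b) by (apply Rdiv_lt_0_compat; lra).
  set (eta := Rmin (rpow (1 / (4 * B)) (1 / p)) (rpow (eps / b) (1 / r))).
  assert (Heta : 0 < eta) by (apply Rmin_glb_lt; apply rpow_gt0; auto).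
  exists eta. split; auto. split.
  - assert (H : rpow eta p <= 1 / (4 * B)).
    { rewrite <- (rpow_root (1 / (4 * B)) p) by lra. apply rpow_le; [lra|apply Rmin_l]. }
    apply (Rmult_le_compat_l B) in H; [|lra]. replace (B * (1 / (4 * B))) with (1 / 4) in H by (field; lra). auto.
  - rewrite rpow_mult, rpow_rpow by (try apply rpow_ge0; lra). fold b.
    replace (p * (1 / q)) with (r + 1) by (unfold r; field; lra).
    rewrite <- rpow_plus, rpow_1 by lra.
    assert (H : rpow eta r <= eps / b).
    { rewrite <- (rpow_root (eps / b) r) by lra. apply rpow_le; [lra|apply Rmin_r]. }
    apply (Rmult_le_compat_l b) in H; [|lra]. replace (b * (eps / b)) with eps in H by (field; lra).
    rewrite <- Rmult_assoc. apply Rmult_le_compat_r; lra.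
Qed.

(** * Separation in X against concentration in both components *)

Theorem theorem5p6 (q1 p q2 : R) (X Y1 Y2 : Banach) (e : nat -> Y1) :
  1 <= q1 -> q1 < p -> p < q2 ->
  infinite_dim X ->
  asymp_unif_smooth X p -> co_banach_saks X p -> ~ contains_l1 X ->
  one_unconditional e -> lower_lq_estimate e q1 ->
  reflexive Y2 -> asymp_unif_smooth Y2 q2 ->
  ~ exists f : X -> Y1 * Y2,
      coarse_lipschitz_embedding (@dX X) (@dsum Y1 Y2) f.
Proof.
  intros Hq1 Hq1p Hpq2 Hinf HXs HXc _ [Hbasis _] Hlow Hrefl HY2 [f (L & HL & Hup & Hdown)].
  apply Rgt_lt in HL.
  assert (Hf1 : forall x y, vnorm (vsub (fst (f x)) (fst (f y))) <= L * vnorm (vsub x y) + L).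
  { intros x y. specialize (Hup _ x y (Rle_refl _)). unfold dsum, dX in Hup.
    pose proof (vnorm_ge0 (vsub (snd (f x)) (snd (f y)))). lra. }
  assert (Hf2 : forall x y, vnorm (vsub (snd (f x)) (snd (f y))) <= L * vnorm (vsub x y) + L).
  { intros x y. specialize (Hup _ x y (Rle_refl _)). unfold dsum, dX in Hup.
    pose proof (vnorm_ge0 (vsub (fst (f x)) (fst (f y)))). lra. }
  assert (Hf : forall x y, vnorm (vsub x y) / L - L <=
    vnorm (vsub (fst (f x)) (fst (f y))) + vnorm (vsub (snd (f x)) (snd (f y)))).
  { intros x y. specialize (Hdown _ x y (Rge_refl _)). unfold dsum, dX in Hdown. lra. }
  destruct free_ultrafilter_exists as (U & HU & Hfree).
  destruct (smooth_coBS_sequence X p ltac:(lra) Hinf HXs HXc) as (s & A & c & HA & Hc & Hs1 & Hsw & Hs).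
  destruct (smooth_step X p ltac:(lra) HXs) as (B & HB & Hstep).
  destruct (hamming_concentration Y2 q2 ltac:(lra) Hrefl HY2) as (A2 & HA2 & Hham).
  assert (HX0 : exists v : X, v <> vzero).
  { exists (s 0%nat). intros E. specialize (Hs1 0%nat). rewrite E, vnorm0 in Hs1. lra. }
  destruct (coarse_midpoint_concentration e q1 (fun z => fst (f z)) L Hq1 Hbasis Hlow HX0 HL Hf1)
    as (C & HC & Hmid).
  (* k is fixed before eta and the points x, y; the constant is the one needed for [HQ3], on the Y2
     component. *)
  destruct (rpow_exponent_gap (1 / q2) (1 / p) (c / (32 * A2 * (L * L)))) as (k & Hk1 & Hk).
  { unfold Rdiv. rewrite !Rmult_1_l. apply Rinv_lt_contravar; nra. }
  { apply Rdiv_lt_0_compat; auto. repeat apply Rmult_lt_0_compat; lra. }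
  apply le_INR in Hk1; simpl in Hk1.
  set (kp := rpow (INR k) (1 / p)) in *. set (k2 := rpow (INR k) (1 / q2)) in *.
  assert (Hkp : 0 < kp) by (apply rpow_gt0; lra). assert (Hk2 : 0 < k2) by (apply rpow_gt0; lra).
  (* eta is chosen for [HQ2], on the Y1 component, and keeps delta within the range of [Hmid]. *)
  destruct (rpow_small_radius B p q1 (c / (32 * A * L * C))) as (eta & Heta & Hd1 & Hd2); try lra.
  { apply Rdiv_lt_0_compat; auto. repeat apply Rmult_lt_0_compat; lra. }
  set (delta := B * rpow eta p) in *.
  assert (Hdelta : 0 < delta) by (apply Rmult_lt_0_compat; auto; apply rpow_gt0; auto).
  assert (Hceta : 0 < c * eta) by nra.
  (* At distance at least T the additive constants of the embedding become negligible: this is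
     [HQ4]. *)
  set (T := (L + 2 * A2 * k2 * L) * (8 * A * L) / (c * eta) + 1).
  assert (HT : 1 <= T).
  { assert (0 < (L + 2 * A2 * k2 * L) * (8 * A * L) / (c * eta)); [|unfold T; lra].
    apply Rdiv_lt_0_compat; auto. repeat apply Rmult_lt_0_compat; try lra.
    assert (0 < A2 * k2 * L) by (repeat apply Rmult_lt_0_compat; lra). lra. }
  destruct (Hmid delta T ltac:(lra)) as (x & y & HD & Hconc). clear Hmid.
  set (D := vnorm (vsub x y)) in *.
  set (w := vscal (1 / 2) (vsub x y)). set (u := vscal (1 / 2) (vadd x y)).
  assert (Hw : vnorm w = D / 2).
  { unfold w. rewrite (vnorm_scal_eq (1 / 2) _ (vsub x y)); [fold D; field|reflexivity|lra]. }
  (* As sums of k terms have norm at most A k^(1/p), this scaling keeps displacements within eta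
     D/2. *)
  set (tau := eta * (D / 2) / (A * kp)).
  assert (HAkp : 0 < A * kp) by nra.
  assert (HetaD : 0 < eta * (D / 2)) by (apply Rmult_lt_0_compat; lra).
  assert (Htau : 0 < tau) by (apply Rdiv_lt_0_compat; auto).
  set (phi := fun l => vadd u (vscal tau (lsum s l))).
  pose proof (uf_power_ultra U k HU) as HV.
  pose proof (lsum_weak_limit s U k HU Hfree Hsw) as Hwl.
  (* Lists increasing from k meet the condition k <= j 0 of the lower estimate. *)
  assert (Hsize : uf_power U k (fun l => length l = k /\
    vnorm (lsum s l) <= A * kp /\ c * kp <= vnorm (lsum s l))).
  { apply (uf_and_mono HV _ _ _ (uf_power_increasing U HU Hfree k k) (uf_power_length U HU k)).
    intros l Hl Hlen. destruct (increasing_from_nth _ _ Hl) as [Hl1 Hl2]. split; auto.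
    rewrite lsum_vsum, Hlen. rewrite Hlen in Hl1, Hl2.
    destruct (Hs k (fun i => nth i l 0%nat) Hl1) as [H1 H2]. split; auto.
    apply H2, Hl2. apply INR_lt; simpl; lra. }
  (* Smoothness at w with radius eta D/2 gives ||w + v||^p <= (1 + delta)(D/2)^p, because B (eta
     D/2)^p = delta (D/2)^p, and 1 + delta <= (1 + delta)^p. The same holds for -v, E being a
     subspace. *)
  assert (Hmids : uf_power U k (fun l => approx_mid x y delta (phi l))).
  { destruct (Hstep w (eta * (D / 2)) HetaD) as (E & sg & HE & Hsg & HEh).
    assert (Hnear : uf_power U k (fun l => near E sg (vsub (vscal tau (lsum s l)) vzero))).
    { apply (weak_limit_near HV _ _ (tau * (A * kp))); auto.
      - apply weak_limit_scal; auto.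
      - apply (uf_mono _ HV _ _ Hsize). intros l (_ & h & _).
        rewrite (vnorm_scal_eq tau _ (lsum s l)); [|reflexivity|lra]. apply Rmult_le_compat_l; lra. }
    apply (uf_and_mono HV _ _ _ Hnear Hsize). intros l Hn (_ & h & _).
    set (v := vscal tau (lsum s l)) in *. replace (vsub v vzero) with v in Hn by vlin.
    assert (Hvn : vnorm v <= eta * (D / 2)).
    { unfold v. rewrite (vnorm_scal_eq tau _ (lsum s l)); [|reflexivity|lra].
      replace (eta * (D / 2)) with (tau * (A * kp)) by (unfold tau; field; lra).
      apply Rmult_le_compat_l; lra. }
    assert (Hmidnorm : forall v', vnorm v' <= eta * (D / 2) -> near E sg v' ->
      vnorm (vadd w v') <= (1 + delta) / 2 * D).
    { intros v' Hv1 Hv2. specialize (HEh v' Hv1 Hv2). rewrite Hw in HEh.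
      rewrite rpow_mult in HEh by lra.
      apply (rpow_le_inv _ _ p); [lra|nra|].
      replace ((1 + delta) / 2 * D) with ((1 + delta) * (D / 2)) by field.
      rewrite rpow_mult by lra. pose proof (rpow_1plus_ge p delta ltac:(lra) ltac:(lra)) as H1.
      pose proof (rpow_ge0 (D / 2) p) as H2.
      apply Rle_trans with ((1 + delta) * rpow (D / 2) p); [unfold delta; lra|].
      apply Rmult_le_compat_r; auto. }
    split; fold D.
    - rewrite (vnorm_opp_eq (vsub (phi l) x) (vadd w (vopp v))).
      + apply Hmidnorm; [rewrite vnorm_opp; auto|].
        destruct Hn as (v1 & Hv1 & Hv2). exists (vopp v1). split.
        * rewrite vopp_scal. apply HE; auto.
        * rewrite (vnorm_opp_eq (vsub (vopp v) (vopp v1)) (vsub v v1)); [auto|vlin].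
      + unfold phi. fold v. unfold w, u. vlin.
    - replace (vsub (phi l) y) with (vadd w v); [apply Hmidnorm; auto|].
      unfold phi. fold v. unfold w, u. vlin. }
  destruct (Hconc _ _ phi HV Hmids) as [y1 Hy1].
  (* Changing one entry of a list moves [phi] by at most 2 tau, the terms being unit vectors. *)
  set (lam := L * (2 * tau) + L).
  assert (Hlam : 0 < lam) by (unfold lam; nra).
  destruct (Hham U k lam (fun l => snd (f (phi l))) (vnorm (snd (f u)) + (L * (tau * INR k) + L)) HU Hlam)
    as [y2 Hy2].
  { intros l1 n n' l2 _. eapply Rle_trans; [apply Hf2|]. unfold lam.
    apply Rplus_le_compat_r, Rmult_le_compat_l; [lra|].
    rewrite (vnorm_scal_eq tau _ (vsub (s n) (s n'))); [|rewrite <- (lsum_update s l1 n n' l2); unfold phi; vlin|lra].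
    pose proof (vnorm_le_add (vsub (s n) (s n')) (s n) (vopp (s n')) ltac:(vlin)) as H.
    rewrite vnorm_opp, !Hs1 in H. nra. }
  { intros l Hl. pose proof (Hf2 (phi l) u) as H.
    rewrite (vnorm_scal_eq tau (vsub (phi l) u) (lsum s l)) in H; [|unfold phi; vlin|lra].
    pose proof (lsum_norm_le s l Hs1) as H1. rewrite Hl in H1.
    pose proof (vnorm_le_add (snd (f (phi l))) (snd (f u)) (vsub (snd (f (phi l))) (snd (f u))) ltac:(vlin)).
    assert (L * (tau * vnorm (lsum s l)) <= L * (tau * INR k)) by (repeat apply Rmult_le_compat_l; lra).
    lra. }
  set (good := fun l => c * kp <= vnorm (lsum s l) /\
    vnorm (vsub (fst (f (phi l))) y1) <= C * rpow delta (1 / q1) * D /\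
    vnorm (vsub (snd (f (phi l))) y2) <= A2 * lam * k2).
  assert (Hgood : uf_power U k good).
  { apply (uf_and_mono HV _ _ _ Hsize (uf_and _ HV _ _ Hy1 Hy2)).
    intros l (_ & _ & h1) [h2 h3]. split; auto. }
  destruct (uf_ex HV _ Hgood) as [l0 (G1 & G2 & G3)].
  (* A second good list is taken on which the functional norming the first sum is small, possible
     since the sums tend weakly to zero. This separates the two sums by c kp/2. *)
  destruct (norming_functional (lsum s l0)) as (g & Hg & Hgn & Hg0).
  destruct (uf_ex HV _ (uf_and _ HV _ _ Hgood (Hwl g Hg (c * kp / 2) ltac:(nra)))) as [l [(G4 & G5 & G6) G7]].
  assert (Hsep : c * kp / 2 <= vnorm (vsub (lsum s l0) (lsum s l))).
  { pose proof (Hgn (vsub (lsum s l0) (lsum s l))) as H. destruct Hg as [Hlin _].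
    rewrite (lin_zero g Hlin), Rminus_0_r in G7. rewrite lin_sub, Hg0 in H by auto.
    apply Rabs_def2 in G7. pose proof (Rle_abs (vnorm (lsum s l0) - g (lsum s l))). lra. }
  specialize (Hf (phi l0) (phi l)).
  rewrite (vnorm_scal_eq tau (vsub (phi l0) (phi l)) (vsub (lsum s l0) (lsum s l))) in Hf;
    [|unfold phi; vlin|lra].
  pose proof (vnorm_le_add (vsub (fst (f (phi l0))) (fst (f (phi l)))) (vsub (fst (f (phi l0))) y1)
    (vopp (vsub (fst (f (phi l))) y1)) ltac:(vlin)) as N1. rewrite vnorm_opp in N1.
  pose proof (vnorm_le_add (vsub (snd (f (phi l0))) (snd (f (phi l)))) (vsub (snd (f (phi l0))) y2)
    (vopp (vsub (snd (f (phi l))) y2)) ltac:(vlin)) as N2. rewrite vnorm_opp in N2.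
  (* All terms are compared with [Q], the separation of the two images up to a factor 4. *)
  set (Q := c * eta * D / (16 * A * L)).
  assert (HAL : 0 < A * L) by nra.
  assert (HQ1 : 4 * Q <= tau * vnorm (vsub (lsum s l0) (lsum s l)) / L).
  { replace (4 * Q) with (tau * (c * kp / 2) / L) by (unfold Q, tau; field; lra).
    apply Rmult_le_compat_r; [left; apply Rinv_0_lt_compat; auto|]. apply Rmult_le_compat_l; lra. }
  assert (HQ2 : 2 * (C * rpow delta (1 / q1) * D) <= Q).
  { replace Q with (2 * (C * (c / (32 * A * L * C) * eta) * D)) by (unfold Q; field; lra).
    apply Rmult_le_compat_l; [lra|]. apply Rmult_le_compat_r; [lra|]. apply Rmult_le_compat_l; lra. }
  assert (HQ3 : 2 * (A2 * (L * (2 * tau)) * k2) <= Q).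
  { replace Q with (2 * (A2 * (L * (2 * tau)) * (c / (32 * A2 * (L * L)) * kp)))
      by (unfold Q, tau; field; lra).
    assert (A2 * (L * (2 * tau)) * k2 <= A2 * (L * (2 * tau)) * (c / (32 * A2 * (L * L)) * kp)); [|lra].
    apply Rmult_le_compat_l; auto. apply Rmult_le_pos; [lra|]. apply Rmult_le_pos; lra. }
  assert (HQ4 : L + 2 * A2 * k2 * L < 2 * Q).
  { assert (H : T * (c * eta) <= D * (c * eta)) by (apply Rmult_le_compat_r; lra).
    unfold T in H. rewrite Rmult_plus_distr_r in H.
    replace ((L + 2 * A2 * k2 * L) * (8 * A * L) / (c * eta) * (c * eta))
      with ((L + 2 * A2 * k2 * L) * (8 * A * L)) in H by (field; repeat split; lra).
    apply (Rmult_lt_reg_r (8 * A * L)); [nra|].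
    replace (2 * Q * (8 * A * L)) with (D * (c * eta)) by (unfold Q; field; repeat split; lra). lra. }
  (* Altogether 4Q - L <= Q + Q + 2 A2 k2 L, contrary to [HQ4]. *)
  unfold lam in *. lra.
Qed.
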